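(* Let $P=\{p_1,\ldots,p_m\}$ be a finite poset, let $\mathcal{A}$ assign to each $p_i$ a non-empty subset $A_i\subseteq[n]$, and let $k\ge1$. Let $J$ be the ideal of $T$ generated by the regular sequence $$X_{i,a}^{(s)}-X_{i,a}^{(s+1)},\qquad i=1,\ldots,m,\ a\in A_i,\ s=1,\ldots,k-1,$$ on $T/\mathcal{L}(P^k,\mathcal{A}^k)$. Let $\mathbb{F}$ be the explicit multigraded minimal free resolution of $T/\mathcal{L}(P^k,\mathcal{A}^k)$ over $T$ described in the context. Then the multigraded minimal free resolution of $R/\mathcal{L}(P,\mathcal{A})^k$ over $R$ is isomorphic to the complex $\mathbb{F}/J\mathbb{F}$ (where $T/J$ is identified with $R$ by sending the class of $X_{i,a}^{(s)}$ to $X_{p_i,a}$ for all $i,a,s$).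
   Context: $n$ is a positive integer, $[n]=\{1,\ldots,n\}$, $\mathbf{K}$ is a field; $p_i<p_j$ implies $i<j$. $R=\mathbf{K}[X_{p_i,a}\mid 1\le i\le m,\ a\in A_i]$, with multigrading given by its variables. For a finite poset $Q$ and a map $\mathcal{B}$ assigning to each $q\in Q$ a non-empty subset $\mathcal{B}_q\subseteq[n]$, $\mathrm{Hom}(Q,\mathcal{B})$ is the set of maps $f:Q\to[n]$ that are isotone ($q\le q'$ implies $f(q)\le f(q')$) with $f(q)\in\mathcal{B}_q$ for all $q$; it is assumed that $\mathrm{Hom}(P,\mathcal{A})\neq\emptyset$. Set $U_f:=\prod_{q\in Q}X_{q,f(q)}$, and let $\mathcal{L}(Q,\mathcal{B})$ be the ideal generated by all $U_f$, $f\in\mathrm{Hom}(Q,\mathcal{B})$. $P^k$ is the poset with underlying set $\{p_{i,j}\mid 1\le i\le m,\ 1\le j\le k\}$ and $p_{i_1,j_1}\le p_{i_2,j_2}$ iff $p_{i_1}\le p_{i_2}$ and $j_1\le j_2$. The map $\mathcal{A}^k$ assigns $A_i$ to $p_{i,j}$. $T=\mathbf{K}[X_{p_{i,j},a}\mid 1\le i\le m,\ 1\le j\le k,\ a\in A_i]$, and $X_{i,a}^{(j)}$ denotes $X_{p_{i,j},a}$. The resolution $\mathbb{F}$: number the elements of $P^k$ as $q_1,\ldots,q_M$, $M=mk$, so that $q_u<q_v$ implies $u<v$, and let $C_u=\mathcal{A}^k(q_u)$. For $K\subseteq[n]$ non-empty write $X_{q_u,K}=\prod_{a\in K}X_{q_u,a}$.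 For $t\ge0$ let $F_t$ be the free $T$-module with basis the symbols $[K_1,\ldots,K_M]$, of multidegree $\prod_u X_{q_u,K_u}$, such that $\emptyset\ne K_u\subseteq C_u$ for all $u$, $\sum_u|K_u|=M+t$, $\max(K_u)\le\min(K_v)$ whenever $q_u<q_v$, and the map $q_u\mapsto\max(K_u)$ lies in $\mathrm{Hom}(P^k,\mathcal{A}^k)$. Then $\mathbb{F}$ is $$0\to F_p\xrightarrow{d_p}\cdots\xrightarrow{d_1}F_0\xrightarrow{d_0}T\to0$$ (resolving $T/\mathcal{L}(P^k,\mathcal{A}^k)$), where $p$ is the largest $t$ with $F_t\ne0$, $d_0([K_1,\ldots,K_M])=\prod_uX_{q_u,K_u}$, and for $t\ge1$ $$d_t([K_1,\ldots,K_M])=\sum_{X_{q_u,a}\in\Omega}(-1)^{\sigma(X_{q_u,a},\overline{\Omega})}X_{q_u,a}[K_1,\ldots,K_u\setminus\{a\},\ldots,K_M],$$ with $\Omega=\{X_{q_u,a}\mid |K_u|\ge2,\ a\in K_u\}$, $\overline{\Omega}=\{X_{q_u,a}\mid a\in K_u\}$, $\overline{\Omega}$ totally ordered by $X_{q_u,a}>X_{q_v,b}$ iff $u<v$ or ($u=v$ and $a<b$), and $\sigma(X_{q_u,a},\overline{\Omega})$ the number of elements of $\overline{\Omega}$ larger than $X_{q_u,a}$. *)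

(* Defs.v *)
From HB Require Import structures.
From mathcomp Require Import all_boot all_order all_algebra.
From mathcomp Require Import generic_quotient ring_quotient.
From mathcomp Require Import boolp.
From mathcomp Require Export mpoly.

Set Implicit Arguments.
Unset Strict Implicit.
Unset Printing Implicit Defensive.

Import Order.TTheory GRing.Theory.
Local Open Scope ring_scope.

(* Ideals and submodules are Prop-valued predicates. *)
Section Span.
Variable S : comNzRingType.

Definition submod_gen (V : lmodType S) (G : V -> Prop) (x : V) : Prop :=
  exists s : seq (S * V),
    (forall p, p \in s -> G p.2) /\ x = \sum_(p <- s) p.1 *: p.2.

Definition ideal_gen (G : S -> Prop) : S -> Prop := @submod_gen S^o G.

Definition ideal_pow (I : S -> Prop) (k : nat) : S -> Prop :=
  ideal_gen (fun x => exists f : 'I_k -> S,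
    (forall i, I (f i)) /\ x = \prod_(i < k) f i).

Definition ideal_smul (I : S -> Prop) (V : lmodType S) : V -> Prop :=
  submod_gen (fun y => exists r v, I r /\ y = r *: v).

Lemma ideal_smul0 (I : S -> Prop) (V : lmodType S) : ideal_smul I (0 : V).
Proof. by exists [::]; split=> //; rewrite big_nil. Qed.

Lemma ideal_smulD (I : S -> Prop) (V : lmodType S) (a : S) (x y : V) :
  ideal_smul I x -> ideal_smul I y -> ideal_smul I (a *: x + y).
Proof.
move=> [s [Gs ->]] [t [Gt ->]].
exists ([seq (a * p.1, p.2) | p <- s] ++ t); split=> [p|].
  by rewrite mem_cat => /orP[/mapP[p' /Gs ? ->]|/Gt].
rewrite big_cat big_map scaler_sumr; congr (_ + _).
by apply: eq_bigr => p _ /=; rewrite scalerA.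
Qed.

Lemma ideal_smul_linear (I : S -> Prop) (V W : lmodType S)
    (f : {linear V -> W}) x : ideal_smul I x -> ideal_smul I (f x).
Proof.
move=> [s [Gs ->]]; exists [seq (p.1, f p.2) | p <- s]; split=> [p|].
  case/mapP => p' /Gs [r [v [Ir def]]] ->.
  by exists r, (f v); split=> //=; rewrite def linearZ.
by rewrite linear_sum big_map; apply: eq_bigr => p _; rewrite linearZ.
Qed.

End Span.

(* The quotient module V / IV, and the maps induced between such quotients. *)
Section QuotientModule.
Variables (S : comNzRingType) (I : S -> Prop) (V : lmodType S).

Definition in_smul : {pred V} := fun x => `[< ideal_smul I x >].

Lemma in_smul_zmod_closed : zmod_closed in_smul.
Proof.
split=> [|x y /asboolP Ix /asboolP Iy]; first exact/asboolP/ideal_smul0.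
by apply/asboolP; rewrite -scaleN1r addrC; apply: ideal_smulD.
Qed.

HB.instance Definition _ :=
  GRing.isZmodClosed.Build V in_smul in_smul_zmod_closed.

Definition mquot := Quotient.quot in_smul.
HB.instance Definition _ := GRing.Zmodule.on mquot.

Definition mquot_pi (x : V) : mquot := \pi_mquot%qT x.
Definition mquot_scale (a : S) (x : mquot) : mquot := mquot_pi (a *: repr x).

Lemma mquot_pi_eq x y : mquot_pi x = mquot_pi y <-> ideal_smul I (x - y).
Proof.
rewrite /mquot_pi; split=> [/eqmodP|H]; last apply/eqmodP.
  by rewrite /= /Quotient.equiv => /asboolP.
by rewrite /= /Quotient.equiv; apply/asboolP.
Qed.

Lemma mquot_pi_repr x : mquot_pi (repr x) = x.
Proof. exact: reprK. Qed.

Lemma mquot_piD : {morph mquot_pi : x y / x + y}.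
Proof. by move=> x y; rewrite /mquot_pi raddfD. Qed.

Lemma mquot_piZ a x : mquot_scale a (mquot_pi x) = mquot_pi (a *: x).
Proof.
apply/mquot_pi_eq; rewrite -scalerBr -[_ *: _]addr0; apply: ideal_smulD.
  by apply/mquot_pi_eq; rewrite mquot_pi_repr.
exact: ideal_smul0.
Qed.

Fact mquot_scaleA a b x :
  mquot_scale a (mquot_scale b x) = mquot_scale (a * b) x.
Proof. by rewrite -[x]mquot_pi_repr !mquot_piZ scalerA. Qed.
Fact mquot_scale1 : left_id 1 mquot_scale.
Proof. by move=> x; rewrite -[x]mquot_pi_repr mquot_piZ scale1r. Qed.
Fact mquot_scaleDr : right_distributive mquot_scale +%R.
Proof.
move=> a x y; rewrite -[x]mquot_pi_repr -[y]mquot_pi_repr -mquot_piD !mquot_piZ.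
by rewrite scalerDr mquot_piD.
Qed.
Fact mquot_scaleDl x : {morph mquot_scale^~ x : a b / a + b}.
Proof. by move=> a b; rewrite -[x]mquot_pi_repr !mquot_piZ scalerDl mquot_piD. Qed.

HB.instance Definition _ := GRing.Zmodule_isLmodule.Build S mquot
  mquot_scaleA mquot_scale1 mquot_scaleDr mquot_scaleDl.

End QuotientModule.

Arguments mquot_pi {S} I {V} x.

Definition mquot_map (S : comNzRingType) (I : S -> Prop) (V W : lmodType S)
  (f : V -> W) (x : mquot I V) : mquot I W := mquot_pi I (f (repr x)).

Lemma mquot_mapE (S : comNzRingType) (I : S -> Prop) (V W : lmodType S)
  (f : {linear V -> W}) (x : V) : mquot_map f (mquot_pi I x) = mquot_pi I (f x).
Proof.
apply/mquot_pi_eq; rewrite -linearB; apply: ideal_smul_linear.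
by apply/mquot_pi_eq; rewrite mquot_pi_repr.
Qed.

(* ... -> F_1 -> F_0 -> S -> 0 over S = K[X_0, ..., X_(N-1)], where F_t is the
   free module on the finite set [cbasis t], whose elements have multidegree
   [cmdeg]; [cd0] and [cd] are the values of d_0 and d_(t+1) on the bases. *)
Record mfcomplex (K : fieldType) (N : nat) := MFComplex {
  cbasis : nat -> finType;
  cmdeg : forall t, cbasis t -> 'X_{1..N};
  cd0 : cbasis 0 -> {mpoly K[N]};
  cd : forall t, cbasis t.+1 -> {ffun cbasis t -> {mpoly K[N]}^o} }.

(* The ^o makes this a {mpoly K[N]}-module, and not just a K-module. *)
Definition cterm (K : fieldType) (N : nat) (F : mfcomplex K N) (t : nat) :
    lmodType {mpoly K[N]} :=
  {ffun cbasis F t -> {mpoly K[N]}^o}.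

Section Complexes.
Variables (K : fieldType) (N : nat).
Implicit Types (F : mfcomplex K N) (I : {mpoly K[N]} -> Prop).
Local Notation S := {mpoly K[N]}.

Section LinExt.
Variables (B : finType) (V : lmodType S) (g : B -> V).
Definition lin_ext (x : {ffun B -> S^o}) : V := \sum_b x b *: g b.
Lemma lin_ext_linear : linear lin_ext.
Proof.
move=> a x y; rewrite /lin_ext scaler_sumr -big_split /=; apply: eq_bigr => b _.
by rewrite !ffunE scalerDl scalerA.
Qed.
HB.instance Definition _ :=
  GRing.isLinear.Build S {ffun B -> S^o} V _ lin_ext lin_ext_linear.
End LinExt.

Definition cdiff0 F : {linear cterm F 0 -> S^o} :=
  lin_ext (V := S^o) (@cd0 _ _ F).
Definition cdiff F t : {linear cterm F t.+1 -> cterm F t} :=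
  lin_ext (@cd _ _ F t).

(* Homogeneity of multidegree mu in the free module F_t: the coefficient of a
   basis element e is a scalar multiple of the monomial X^(mu - deg e). *)
Definition mhomog F t (mu : 'X_{1..N}) (x : cterm F t) : Prop :=
  forall e m, m \in msupp (x e) -> (m + cmdeg e)%MM = mu.

Definition multigraded F : Prop :=
  (forall e m, m \in msupp (@cd0 _ _ F e) -> m = cmdeg e) /\
  (forall t (e : cbasis F t.+1), mhomog (F := F) (cmdeg e) (cd e)).

(* F is a resolution of S/I, in the sense that S is the last term and I the
   image of d_0. *)
Definition resolves F I : Prop :=
  [/\ forall s, I s <-> exists x, cdiff0 F x = s,
      forall x, cdiff0 F x = 0 <-> exists y, cdiff F 0 y = x
    & forall t x, cdiff F t x = 0 <-> exists y, cdiff F t.+1 y = x].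

Definition irrelevant : S -> Prop := ideal_gen (fun x => exists i, x = 'X_i).

Definition minimal F : Prop :=
  (forall x, ideal_smul irrelevant (cdiff0 F x)) /\
  (forall t x, ideal_smul irrelevant (cdiff F t x)).

Definition multigraded_minimal_free_resolution F I : Prop :=
  [/\ multigraded F, resolves F I & minimal F].

End Complexes.

(* F/JF and G are isomorphic multigraded complexes, where F lives over T, G
   over R, and T/J is identified with R through rho : T -> R, which acts on
   multidegrees as rhodeg; phi0 and phi t are the components on T/J and on
   F_t/JF_t. *)
Definition quotient_complex_iso (K : fieldType) (NT NR : nat)
    (rho : {mpoly K[NT]} -> {mpoly K[NR]}) (rhodeg : 'X_{1..NT} -> 'X_{1..NR})
    (F : mfcomplex K NT) (J : {mpoly K[NT]} -> Prop) (G : mfcomplex K NR) :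
    Prop :=
  exists (phi0 : mquot J {mpoly K[NT]}^o -> {mpoly K[NR]})
         (phi : forall t, mquot J (cterm F t) -> cterm G t),
  [/\ bijective phi0 /\ (forall s, phi0 (mquot_pi J s) = rho s),
      forall t, bijective (phi t),
      forall t a x y, phi t (a *: x + y) = rho a *: phi t x + phi t y,
      (forall x, phi0 (mquot_map (cdiff0 F) x) = cdiff0 G (phi 0 x)) /\
      (forall t x, phi t (mquot_map (cdiff F t) x) = cdiff G t (phi t.+1 x))
    & forall t mu x, mhomog mu x -> mhomog (rhodeg mu) (phi t (mquot_pi J x))].

Section LetterplaceIdeal.
Variables (K : fieldType) (n : nat) (d : Order.disp_t) (Q : finPOrderType d).
Variable B : Q -> {set 'I_n}.

(* [n] is represented by 'I_n = {0, ..., n-1}. *)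
Definition isotone_maps : {set {ffun Q -> 'I_n}} :=
  [set f : {ffun Q -> 'I_n} |
     [forall x, forall y, (x <= y)%O ==> (f x <= f y)%N] && [forall x, f x \in B x]].

(* The variables X_(x,a), for a in B_x; they are enumerated to fit in the type
   of multivariate polynomials. *)
Definition pvar : predArgType := {xa : Q * 'I_n | xa.2 \in B xa.1}.
Definition pvar_val (i : 'I_#|pvar|) : Q * 'I_n := val (enum_val i).

(* Exponent of X_(x,a); the junk values when a is not in B_x are 0, and 1 for
   the monomial below. *)
Definition Xdeg (x : Q) (a : 'I_n) : 'X_{1..#|pvar|} :=
  [multinom (pvar_val i == (x, a)) : nat | i < #|pvar|].
Definition Xvar x a : {mpoly K[#|pvar|]} := 'X_[Xdeg x a].

Definition letterplace : {mpoly K[#|pvar|]} -> Prop :=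
  ideal_gen (fun u => exists2 f : {ffun Q -> 'I_n},
    f \in isotone_maps & u = \prod_x Xvar x (f x)).

Variables (M : nat) (q : 'I_M -> Q).
Implicit Type Ks : {ffun 'I_M -> {set 'I_n}}.

(* [K_1, ..., K_M] is a basis element of F_t; in the last clause f is the map
   q_u |-> max K_u. *)
Definition is_symbol t Ks : bool :=
  [&& [forall u, (Ks u != set0) && (Ks u \subset B (q u))],
      (\sum_u #|Ks u| == M + t)%N,
      [forall u, forall v, (q u < q v)%O ==>
         [forall a in Ks u, forall b in Ks v, (a <= b)%N]]
    & [exists f : {ffun Q -> 'I_n} in isotone_maps, forall u,
         (f (q u) \in Ks u) && [forall a in Ks u, (a <= f (q u))%N]]].

Definition symbol t : predArgType := {Ks | is_symbol t Ks}.

Definition symbol_rem Ks (u : 'I_M) (a : 'I_n) : {ffun 'I_M -> {set 'I_n}} :=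
  [ffun v => if v == u then Ks v :\ a else Ks v].

(* The variables counted are those larger than X_(q_u,a): smaller indices give
   larger variables. *)
Definition sigma Ks (u : 'I_M) (a : 'I_n) : nat :=
  #|[set vb : 'I_M * 'I_n | (vb.2 \in Ks vb.1)
       && ((vb.1 < u)%N || ((vb.1 == u) && (vb.2 < a)%N))]|.

Definition symbol_deg Ks : 'X_{1..#|pvar|} :=
  (\sum_u \sum_(a in Ks u) Xdeg (q u) a)%MM.

Definition symbol_d0 Ks : {mpoly K[#|pvar|]} :=
  \prod_u \prod_(a in Ks u) Xvar (q u) a.

(* The indicator is the basis element K with a removed from K_u, which is again
   a symbol. *)
Definition symbol_d t Ks : {ffun symbol t -> {mpoly K[#|pvar|]}^o} :=
  \sum_u \sum_(a in Ks u | (2 <= #|Ks u|)%N)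
    ((-1) ^+ sigma Ks u a * Xvar (q u) a) *:
      [ffun e : symbol t => (val e == symbol_rem Ks u a)%:R].

Definition letterplace_resolution : mfcomplex K #|pvar| :=
  @MFComplex K #|pvar| symbol (fun t e => symbol_deg (val e))
    (fun e => symbol_d0 (val e)) (fun t e => symbol_d t (val e)).

End LetterplaceIdeal.

Arguments letterplace K [n d Q] B _.

Section Power.
Variables (K : fieldType) (n k : nat) (d : Order.disp_t) (P : finPOrderType d).
Variable A : P -> {set 'I_n}.

Definition pow_poset := (P *p 'I_k)%type.
Definition pow_map (x : pow_poset) : {set 'I_n} := A x.1.

(* J is generated by the X_(i,a)^(s) - X_(i,a)^(s+1). *)
Definition diag_ideal : {mpoly K[#|pvar pow_map|]} -> Prop :=
  ideal_gen (fun x => exists p a (s s' : 'I_k),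
    [/\ a \in A p, s' = s.+1 :> nat
      & x = Xvar K pow_map (p, s) a - Xvar K pow_map (p, s') a]).

(* The morphism T -> R mapping X_(i,a)^(s) to X_(i,a), and its effect on
   multidegrees. *)
Definition diag_map : {mpoly K[#|pvar pow_map|]} -> {mpoly K[#|pvar A|]} :=
  comp_mpoly
    [tuple Xvar K A (pvar_val i).1.1 (pvar_val i).2 | i < #|pvar pow_map|].
Definition diag_deg (m : 'X_{1..#|pvar pow_map|}) : 'X_{1..#|pvar A|} :=
  (\sum_(i < #|pvar pow_map|)
    Xdeg A (pvar_val i).1.1 (pvar_val i).2 *+ m i)%MM.

End Power.

Arguments diag_ideal K [n] k [d P] A _.
Arguments diag_map K [n] k [d P] A _.
Arguments diag_deg [n] k [d P] A m.

(* Main.v *)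
Require Import Defs.
From mathcomp Require Import all_boot all_order all_algebra.
From HB Require Import structures.
From mathcomp Require Import boolp.

Set Implicit Arguments.
Unset Strict Implicit.
Unset Printing Implicit Defensive.

(** The specialization [rho : T -> R] sending every X_(i,a)^(s) to X_(i,a) turns
    the resolution of T/L(P^k, A^k) into a complex over R on the same symbols,
    [power_resolution].  As [rho] is onto with kernel J ([diag_map_ker]), this
    complex is F/JF.  So two things have to be shown: that it is a multigraded
    minimal free resolution of R/L(P, A)^k ([power_mmfr]), and that such
    resolutions are unique up to isomorphism ([resolution_unique]).

    Exactness is proved directly for the specialized complex, one multidegree mu
    at a time ([power_exact]).  In degree mu a multigraded complex of free
    modules is a complex of K-vector spaces with the basis elements of degree
    at most mu as a basis ([strand_lin_ext]); here this is the span of the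
    tuples (K_u) of degree at most mu, with a signed boundary that removes one
    element of one K_u without emptying it.  Such a complex is acyclic for the
    following reason ([cycle_bounds]).  Given a cycle c, let u be the last index
    and b the largest element occurring in a K_u on the support of c.  Then b can
    be added to K_u in every tuple of the support without leaving the complex.
    The order conditions are clear.  The degree is the delicate point: by the
    order conditions, an index v < u with the same poset component can contain b
    only if K_u does, so adding b to K_u makes b occur at most as often as in the
    tuple that supplied b ([admissible_le_cone]).  Coning off with apex b hence
    makes c homologous to a cycle all of whose tuples have K_u = {b}.
    Continuing with u - 1, one ends with multiples of a single tuple of
    singletons, which the augmentation kills.

    The image of d_0 is L(P, A)^k because k isotone maps P -> [n] can be sorted
    pointwise: the order statistics form an isotone map on P^k with the same
    product of variables ([order_statistics]).

    For uniqueness, two minimal homogeneous covers of one submodule of a free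
    module lift to each other, and a composite of the two lifts is 1 + N where N
    strictly lowers the degree of the basis elements, hence bijective
    ([unitriangular_bijective], [minimal_cover_unique]).  Applied to the kernels
    one homological degree after the other, this yields the isomorphism. *)

Import Order.TTheory GRing.Theory.
Local Open Scope ring_scope.

(** * Graded free modules and minimal covers *)

Lemma lin_extE (K : fieldType) (N : nat) (B : finType) (V : lmodType {mpoly K[N]})
  (g : B -> V) x : lin_ext g x = \sum_b x b *: g b.
Proof. by []. Qed.

Section Strands.
Variables (K : fieldType) (N : nat).
Local Notation S := {mpoly K[N]}.
Local Notation mon := 'X_{1..N}.

Section OneModule.
Variables (B : finType) (deg : B -> mon).
Implicit Types (x y : {ffun B -> S^o}) (mu nu : mon).

(** The K-linear degree-mu part of a free module: in degree mu, a basis element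
    [e] contributes the multiples of X^(mu - deg e), and [strand] reads off the
    scalar. *)
Definition strand mu x (e : B) : K :=
  if (deg e <= mu)%MM then (x e : S)@_(mu - deg e) else 0.

Definition has_mdeg mu x : Prop :=
  forall e m, m \in msupp (x e : S) -> (m + deg e)%MM = mu.

Lemma strand_mcoeff x e m : strand (m + deg e) x e = (x e : S)@_m.
Proof. by rewrite /strand lem_addl addmK. Qed.

Lemma strand_deg mu x e : deg e = mu -> strand mu x e = (x e : S)@_0.
Proof. by move=> <-; rewrite -{1}[deg e]add0m strand_mcoeff. Qed.

Lemma strand_inj x y : (forall mu e, strand mu x e = strand mu y e) -> x = y.
Proof.
move=> eqxy; apply/ffunP => e; apply/mpolyP => m.
by rewrite -!strand_mcoeff.
Qed.

Lemma strand0 mu e : strand mu 0 e = 0.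
Proof. by rewrite /strand ffunE mcoeff0 if_same. Qed.

(** The strands can be prescribed freely, as long as only finitely many are
    nonzero.  This allows exactness to be checked one multidegree at a time. *)
Lemma strand_glue (c : mon -> B -> K) (l : seq mon) :
    (forall mu e, ~~ (deg e <= mu)%MM -> c mu e = 0) ->
    (forall mu, mu \notin l -> forall e, c mu e = 0) ->
  exists x, forall mu e, strand mu x e = c mu e.
Proof.
move=> c_le c_fin.
(* Removing duplicates from l makes each degree contribute once. *)
exists [ffun e => ((\sum_(mu <- undup l | (deg e <= mu)%MM)
                    (c mu e *: 'X_[mu - deg e] : S)) : S^o)].
move=> nu e; rewrite /strand; case: ifPn => [le_e|/c_le->//].
rewrite ffunE (@raddf_sum _ _ (mcoeff _)).
under eq_bigr => mu _ do rewrite /= mcoeffZ mcoeffX.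
have [l_nu|l_nu] := boolP (nu \in l); last first.
  rewrite c_fin // big_seq_cond big1 // => mu /andP[]; rewrite mem_undup => l_mu le_mu.
  case: eqP => [eq_mu|]; last by rewrite mulr0.
  by rewrite -(submK le_e) -eq_mu submK // l_mu in l_nu.
rewrite big_mkcond (bigD1_seq nu) ?undup_uniq ?mem_undup //= le_e eqxx mulr1.
rewrite big1 ?addr0 // => mu ne_mu; case: ifP => // le_mu.
case: eqP => [eq_mu|]; last by rewrite mulr0.
by case/eqP: ne_mu; rewrite -(submK le_mu) eq_mu submK.
Qed.

Lemma strand_finite x : exists l : seq mon,
  forall mu, mu \notin l -> forall e, strand mu x e = 0.
Proof.
exists [seq (m + deg e)%MM | e <- enum B, m <- msupp (x e : S)] => mu l_mu e.
rewrite /strand; case: ifP => // le_e; apply: memN_msupp_eq0.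
apply: contra l_mu => x_e; apply/allpairsPdep; exists e, (mu - deg e)%MM.
by rewrite mem_enum x_e submK.
Qed.

Lemma has_mdegP mu x :
  has_mdeg mu x <-> (forall nu e, nu != mu -> strand nu x e = 0).
Proof.
split=> [hx nu e ne|hx e m].
  rewrite /strand; case: ifP => // le_e; apply: memN_msupp_eq0.
  by apply: contra ne => /hx <-; rewrite submK.
rewrite mcoeff_msupp -strand_mcoeff => ne; apply/eqP; apply: contraNT ne.
by move/hx=> ->.
Qed.

(** The projection to one multidegree. *)
Lemma has_mdeg_component mu x : exists2 y, has_mdeg mu y
  & forall e, strand mu y e = strand mu x e.
Proof.
have [||y yE] := @strand_glue
  (fun nu e => if nu == mu then strand mu x e else 0) [:: mu].
- by move=> nu e ne; case: eqP => // <-; rewrite /strand (negPf ne).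
- by move=> nu; rewrite inE => /negPf ->.
exists y => [|e]; last by rewrite yE eqxx.
by apply/has_mdegP => nu e ne; rewrite yE (negPf ne).
Qed.

Lemma has_mdeg_coeff mu x e : has_mdeg mu x ->
  x e = if (deg e <= mu)%MM then strand mu x e *: ('X_[mu - deg e] : S) else 0.
Proof.
move=> hx; apply/mpolyP => m; rewrite -strand_mcoeff.
have [eqmu|ne] := eqVneq (m + deg e)%MM mu.
  by rewrite -eqmu lem_addl mcoeffZ mcoeffX addmK eqxx mulr1.
rewrite (proj1 (has_mdegP _ _) hx) //; case: ifP => [le_e|]; last by rewrite mcoeff0.
rewrite mcoeffZ mcoeffX; case: eqP => [eqm|]; last by rewrite mulr0.
by rewrite -eqm submK ?eqxx in ne.
Qed.

End OneModule.

Section LinExtTheory.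
Variables (B : finType) (V : lmodType S) (g : B -> V).

Lemma lin_extB x y : lin_ext g (x - y) = lin_ext g x - lin_ext g y.
Proof. exact: linearB. Qed.

Lemma lin_extZ (a : S) x : lin_ext g (a *: x) = a *: lin_ext g x.
Proof. exact: linearZ. Qed.

Lemma lin_ext_sum (I : Type) (r : seq I) (P : pred I) (F : I -> {ffun B -> S^o}) :
  lin_ext g (\sum_(i <- r | P i) F i) = \sum_(i <- r | P i) lin_ext g (F i).
Proof. exact: linear_sum. Qed.

End LinExtTheory.

Lemma lin_ext_delta (B : finType) (V : lmodType S) (g : B -> V) e :
  lin_ext g [ffun e' => ((e' == e)%:R : S^o)] = g e.
Proof.
rewrite lin_extE (bigD1 e) //= ffunE eqxx scale1r big1 ?addr0 // => e' /negPf ne.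
by rewrite ffunE ne scale0r.
Qed.

Lemma lin_ext_coef (B1 B2 : finType) (g : B1 -> {ffun B2 -> S^o}) x f :
  lin_ext g x f = \sum_e (x e : S) * (g e f : S).
Proof. by rewrite lin_extE sum_ffunE; apply: eq_bigr => e _; rewrite ffunE. Qed.

Section OneMap.
Variables (B1 B2 : finType) (deg1 : B1 -> mon) (deg2 : B2 -> mon).
Variable g : B1 -> {ffun B2 -> S^o}.
Hypothesis g_homog : forall e, has_mdeg deg2 (deg1 e) (g e).
Arguments g_homog : clear implicits.

(** A homogeneous linear map acts on every strand through one and the same scalar
    matrix, since its entries are scalars times the monomials X^(deg e - deg f). *)
Lemma strand_lin_ext mu x f : strand deg2 mu (lin_ext g x) f
  = \sum_e strand deg1 mu x e * strand deg2 (deg1 e) (g e) f.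
Proof.
rewrite {1}/strand lin_ext_coef (@raddf_sum _ _ (mcoeff _)) /=.
case: ifPn => [le_f|nle_f]; last first.
  rewrite big1 // => e _; rewrite /strand; case: ifP => le_e; last by rewrite mul0r.
  case: ifP => le_f; last by rewrite mulr0.
  by rewrite (lepm_trans le_f le_e) in nle_f.
apply: eq_bigr => e _; rewrite (has_mdeg_coeff _ (g_homog e)).
case: ifPn => [le_fe|nle_fe]; last first.
  by rewrite mulr0 mcoeff0 {2}/strand (negPf nle_fe) mulr0.
rewrite -scalerAr mcoeffZ [RHS]mulrC; congr (_ * _).
rewrite {1}/strand; case: ifPn => [le_e|nle_e].
  have -> : (mu - deg2 f = (mu - deg1 e) + (deg1 e - deg2 f))%MM.
    by rewrite addmBA // submK.
  by rewrite addmC mcoeffMX.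
apply: memN_msupp_eq0; apply: contra nle_e; rewrite (perm_mem (msuppMX _ _)).
case/mapP=> m _ eqm; rewrite -(submK le_f) eqm.
by rewrite -addmA [(m + _)%MM]addmC addmA submK // lem_addr.
Qed.

Lemma lin_ext_has_mdeg mu x : has_mdeg deg1 mu x -> has_mdeg deg2 mu (lin_ext g x).
Proof.
move/has_mdegP=> hx; apply/has_mdegP => nu f ne; rewrite strand_lin_ext big1 // => e _.
by rewrite hx ?mul0r.
Qed.

End OneMap.

Lemma injective_surjective_bijective (T : choiceType) (U : eqType) (f : T -> U) :
  injective f -> (forall y, exists x, f x = y) -> bijective f.
Proof.
move=> f_inj f_surj; have ex y : exists x, f x == y by case: (f_surj y) => x <-; exists x.
by exists (fun y => xchoose (ex y)) => [x|y]; [apply: f_inj|]; rewrite (eqP (xchooseP (ex _))).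
Qed.

Lemma irrelevant_coef0 (B : finType) (x : {ffun B -> S^o}) e :
  ideal_smul (@irrelevant K N) x -> (x e : S)@_0 = 0.
Proof.
have irr0 r : irrelevant r -> (r : S)@_0 = 0.
  case=> s [Gs ->]; rewrite (@raddf_sum _ _ (mcoeff _)) big_seq big1 //= => p.
  case/Gs=> i ->; rewrite -[_ *: _]/(p.1 * _) [LHS](rmorphM (mcoeff 0)).
  by rewrite /= mcoeffX mnm1_eq0 mulr0.
case=> s [Gs ->]; rewrite sum_ffunE (@raddf_sum _ _ (mcoeff _)) big_seq big1 //= => p.
case/Gs=> r [v [/irr0 r0 ->]]; rewrite !ffunE -[_ *: _]/(p.1 * (r * (v e : S))).
by rewrite [LHS](rmorphM (mcoeff 0)) [X in _ * X](rmorphM (mcoeff 0)) /= r0 mul0r mulr0.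
Qed.

Section Unitriangular.
Variables (B : finType) (deg : B -> mon) (p : B -> {ffun B -> S^o}).
Hypothesis p_mdeg : forall e, has_mdeg deg (deg e) (p e).
Arguments p_mdeg : clear implicits.
Hypothesis p_const : forall e f, (p e f : S)@_0 = (e == f)%:R.

Let p_coef0 e f : (mdeg (deg e) <= mdeg (deg f))%N -> f != e -> p e f = 0.
Proof.
move=> le_ef ne; rewrite (has_mdeg_coeff _ (p_mdeg e)); case: ifP => // le_f.
have eqd : deg f = deg e.
  apply/mnmP => i; apply/eqP; rewrite eqn_leq (mnm_lepP le_f) /=.
  have := le_ef; rewrite -{1}(submK le_f) mdegD -{2}[mdeg (deg f)]add0n leq_add2r leqn0.
  by rewrite mdeg_eq0 => /eqP e0; rewrite -(submK le_f) e0 add0m.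
by rewrite strand_deg // p_const eq_sym (negPf ne) scale0r.
Qed.

Let p_diag e : p e e = 1.
Proof.
rewrite (has_mdeg_coeff _ (p_mdeg e)) lepm_refl strand_deg //.
have -> : (deg e - deg e)%MM = 0%MM by rewrite -{1}[deg e]add0m addmK.
by rewrite p_const eqxx scale1r mpolyX0.
Qed.

(** An off-diagonal entry of a homogeneous matrix without constant term is a
    multiple of a nontrivial monomial, so that it relates basis elements of
    strictly different total degrees: the matrix is unitriangular for any order of
    the basis by total degree. *)
Lemma unitriangular_bijective : bijective (lin_ext p).
Proof.
apply: injective_surjective_bijective.
  apply: raddf_inj => x px0; apply/ffunP => e; rewrite ffunE.
  (* Triangularity: the coefficients at basis elements of larger degree vanish first. *)
  have [k] := ubnP (\max_f mdeg (deg f) - mdeg (deg e)).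
  elim: k e => // k IHk e; rewrite ltnS => le_k.
  have := lin_ext_coef p x e; rewrite px0 ffunE (bigD1 e) //= p_diag mulr1.
  rewrite big1 ?addr0 // => f ne.
  have [le_f|lt_f] := leqP (mdeg (deg f)) (mdeg (deg e)).
    by rewrite p_coef0 ?mulr0 // eq_sym.
  rewrite IHk ?mul0r //; apply: leq_trans le_k; apply: ltn_sub2l => //.
  by apply: leq_trans lt_f _; apply: (@leq_bigmax _ (fun f => mdeg (deg f))).
have delta_im e : exists x, lin_ext p x = [ffun e' => ((e' == e)%:R : S^o)].
  (* Surjectivity is proved in the opposite direction, from small degrees upwards. *)
  have [k] := ubnP (mdeg (deg e)).
  elim: k e => // k IHk e; rewrite ltnS => le_k.
  have ex f : exists x, (mdeg (deg f) < mdeg (deg e))%N ->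
      lin_ext p x = [ffun e' => ((e' == f)%:R : S^o)].
    case: ltnP => [lt_f|]; last by exists 0.
    by have [|x xE] := IHk f; [exact: leq_trans le_k | exists x].
  have [x xE] := choice ex.
  exists ([ffun e' => ((e' == e)%:R : S^o)]
    - \sum_(f | (mdeg (deg f) < mdeg (deg e))%N) (p e f : S) *: x f).
  rewrite lin_extB lin_ext_sum lin_ext_delta.
  under eq_bigr => f lt_f do rewrite lin_extZ xE //.
  apply/ffunP => f; rewrite !ffunE sum_ffunE.
  have -> : \sum_(f' | (mdeg (deg f') < mdeg (deg e))%N)
      ((p e f' : S) *: [ffun e' => ((e' == f')%:R : S^o)] : {ffun B -> S^o}) f
    = \sum_(f' | (mdeg (deg f') < mdeg (deg e))%N) (p e f' : S) * (f == f')%:R :> S.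
    by apply: eq_bigr => f' _; rewrite ffunE ffunE.
  have [->|ne_fe] := eqVneq f e.
    rewrite p_diag big1 ?subr0 // => f' lt_f.
    by case: eqP lt_f => [->|]; rewrite ?ltnn // mulr0.
  have [lt_f|le_f] := ltnP (mdeg (deg f)) (mdeg (deg e)).
    rewrite (bigD1 f) //= eqxx mulr1 big1 => [|f' /andP[_ ne]].
      by rewrite addr0 subrr.
    by rewrite eq_sym (negPf ne) mulr0.
  rewrite p_coef0 // big1 ?subr0 // => f' lt_f.
  by case: eqP lt_f => [<-|]; rewrite ?mulr0 // ltnNge le_f.
have [x xE] := choice delta_im.
move=> y; exists (\sum_e (y e : S) *: x e); rewrite lin_ext_sum.
transitivity (\sum_e (y e : S) *: ([ffun e' => ((e' == e)%:R : S^o)] : {ffun B -> S^o})).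
  by apply: eq_bigr => e _; rewrite lin_extZ xE.
apply/ffunP=> f; rewrite sum_ffunE.
transitivity (\sum_e (y e : S) * (f == e)%:R).
  by apply: eq_bigr => e _; rewrite ffunE ffunE.
rewrite (bigD1 f) //= eqxx mulr1 big1 ?addr0 // => e ne.
by rewrite eq_sym (negPf ne) mulr0.
Qed.

End Unitriangular.

Section Covers.
Variables (C : finType) (degC : C -> mon).
Local Notation V := {ffun C -> S^o}.

Lemma lin_ext_comp (B1 B2 : finType) (p : B1 -> {ffun B2 -> S^o}) (V0 : lmodType S)
  (g : B2 -> V0) x : lin_ext g (lin_ext p x) = lin_ext (fun e => lin_ext g (p e)) x.
Proof. by rewrite [lin_ext p x]lin_extE lin_ext_sum; apply: eq_bigr => e _; rewrite lin_extZ. Qed.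

(** Lifting along a homogeneous map preserves degrees after replacing each chosen
    preimage by its component of the right degree. *)
Lemma lift_mdeg (B1 B2 : finType) (deg1 : B1 -> mon) (deg2 : B2 -> mon)
    (g1 : B1 -> V) (g2 : B2 -> V) :
    (forall e, has_mdeg degC (deg1 e) (g1 e)) ->
    (forall e, has_mdeg degC (deg2 e) (g2 e)) ->
    (forall x, exists y, lin_ext g2 y = lin_ext g1 x) ->
  exists p : B1 -> {ffun B2 -> S^o},
    (forall e, has_mdeg deg2 (deg1 e) (p e)) /\
    (forall x, lin_ext g2 (lin_ext p x) = lin_ext g1 x).
Proof.
move=> h1 h2 im12.
have ex e : exists x, has_mdeg deg2 (deg1 e) x /\ lin_ext g2 x = g1 e.
  have [y yE] := im12 [ffun e' => ((e' == e)%:R : S^o)].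
  rewrite lin_ext_delta in yE.
  have [x hx xE] := has_mdeg_component deg2 (deg1 e) y.
  exists x; split; first exact: hx.
  apply: (@strand_inj _ degC) => mu f.
  have [->|ne] := eqVneq mu (deg1 e); last first.
    rewrite (proj1 (has_mdegP _ _ _) (h1 e)) //.
    by apply: (proj1 (has_mdegP _ _ _) (lin_ext_has_mdeg h2 hx)).
  have lin z := strand_lin_ext h2 (deg1 e) z f.
  transitivity (strand degC (deg1 e) (lin_ext g2 y) f); last by congr (strand _ _ _ _).
  apply: etrans (lin x) _.
  apply: etrans _ (esym (lin y)).
  apply: eq_bigr => e' _.
  congr (_ * _).
 exact: xE.
have [p pE] := choice ex.
exists p; split=> [e|x]; first by case: (pE e).
by rewrite lin_ext_comp; apply: eq_bigr => e _; congr (_ *: _); case: (pE e).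
Qed.

(** Lift the two covers to each other.  A composite of the lifts differs from the
    identity by elements of the kernel of a cover, hence by elements of the
    irrelevant ideal times the module. *)
Lemma minimal_cover_unique (B1 B2 : finType) (deg1 : B1 -> mon) (deg2 : B2 -> mon)
    (g1 : B1 -> V) (g2 : B2 -> V) :
    (forall e, has_mdeg degC (deg1 e) (g1 e)) ->
    (forall e, has_mdeg degC (deg2 e) (g2 e)) ->
    (forall y, (exists x, lin_ext g1 x = y) <-> (exists x, lin_ext g2 x = y)) ->
    (forall x, lin_ext g1 x = 0 -> ideal_smul (@irrelevant K N) x) ->
    (forall x, lin_ext g2 x = 0 -> ideal_smul (@irrelevant K N) x) ->
  exists p : B1 -> {ffun B2 -> S^o},
    [/\ forall e, has_mdeg deg2 (deg1 e) (p e), bijective (lin_ext p)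
      & forall x, lin_ext g2 (lin_ext p x) = lin_ext g1 x].
Proof.
move=> h1 h2 im12 ker1 ker2.
have [|p [hp pE]] := lift_mdeg h1 h2; first by move=> x; apply/im12; exists x.
have [|p' [hp' pE']] := lift_mdeg h2 h1; first by move=> x; apply/im12; exists x.
have comp_bij (B B' : finType) (deg : B -> mon) (deg' : B' -> mon)
    (g : B -> V) (g' : B' -> V) (r : B -> {ffun B' -> S^o}) (r' : B' -> {ffun B -> S^o}) :
    (forall e, has_mdeg deg' (deg e) (r e)) -> (forall e, has_mdeg deg (deg' e) (r' e)) ->
    (forall x, lin_ext g x = 0 -> ideal_smul (@irrelevant K N) x) ->
    (forall x, lin_ext g' (lin_ext r x) = lin_ext g x) ->
    (forall x, lin_ext g (lin_ext r' x) = lin_ext g' x) ->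
    bijective (lin_ext r' \o lin_ext r).
  move=> hr hr' ker_g rE rE'.
  have -> : lin_ext r' \o lin_ext r = lin_ext (fun e => lin_ext r' (r e)).
    by apply/funext => x; apply: lin_ext_comp.
  apply: (@unitriangular_bijective _ deg) => e; first exact: (lin_ext_has_mdeg hr').
  move=> f; pose de : {ffun B -> S^o} := [ffun e' => ((e' == e)%:R : S^o)].
  have /ker_g/(irrelevant_coef0 f) : lin_ext g (lin_ext r' (r e) - de) = 0.
    by rewrite lin_extB rE' -[r e]lin_ext_delta rE subrr.
  rewrite !ffunE mcoeffB => /eqP; rewrite subr_eq0 => /eqP ->.
  by rewrite eq_sym -mpolyC_nat mcoeffC eqxx mulr1.
have [q1 q1K q1K'] := comp_bij _ _ _ _ _ _ _ _ hp hp' ker1 pE pE'.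
have [q2 q2K q2K'] := comp_bij _ _ _ _ _ _ _ _ hp' hp ker2 pE' pE.
exists p; split=> //; apply: injective_surjective_bijective => [x y eqp|y].
  by apply: (can_inj q1K); rewrite /= eqp.
by exists (lin_ext p' (q2 y)); apply: q2K'.
Qed.

End Covers.

End Strands.

(** * The relative boundary on tuples of finite sets *)

(** The cancellation behind d d = 0.  Splitting along a strict order on the
    indices, instead of dividing by 2, keeps it valid in characteristic 2. *)
Lemma sum_antisym (V : zmodType) (I : finType) (lt : rel I) (f : I -> I -> V) :
    (forall x y, x != y -> lt x y = ~~ lt y x) -> (forall x, ~~ lt x x) ->
    (forall x, f x x = 0) -> (forall x y, f x y = - f y x) ->
  \sum_x \sum_y f x y = 0.
Proof.
move=> lt_anti lt_irr f_diag f_anti.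
rewrite (eq_bigr (fun x => \sum_(y | lt x y) f x y + \sum_(y | lt y x) f x y)).
  rewrite big_split /= [X in _ + X](exchange_big_dep xpredT) //= -big_split big1 //= => x _.
  by rewrite -big_split big1 //= => y _; rewrite f_anti addNr.
move=> x _; rewrite (bigID (lt x)) /=; congr (_ + _).
rewrite (bigD1 x) //= f_diag add0r; apply: eq_bigl => y.
have [->|ne] := eqVneq y x; first by rewrite (negPf (lt_irr x)) andbF.
by rewrite lt_anti ?negbK ?andbT // eq_sym.
Qed.

Section Chains.
Variables (K : fieldType) (M n : nat).
Local Notation tup := {ffun 'I_M -> {set 'I_n}}.
Local Notation cell := ('I_M * 'I_n)%type.
Implicit Types (L : tup) (x y z : cell) (c : tup -> K).

Definition has_cell L x := x.2 \in L x.1.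
Definition add_cell L x : tup := [ffun v => if v == x.1 then x.2 |: L v else L v].
Definition cell_lt x y := (x.1 < y.1)%N || ((x.1 == y.1) && (x.2 < y.2)%N).
Definition csign L x : K := (-1) ^+ sigma L x.1 x.2.

Lemma cell_ltNge x y : x != y -> cell_lt x y = ~~ cell_lt y x.
Proof.
case: x y => [u a] [v b]; rewrite xpair_eqE /cell_lt -!(inj_eq val_inj) /=.
by case: (ltngtP u v) => //= _ ne; rewrite -leqNgt ltn_neqAle ne.
Qed.

Lemma cell_lt_irr x : ~~ cell_lt x x.
Proof. by rewrite /cell_lt !ltnn andbF. Qed.

Lemma has_add L x y : has_cell (add_cell L x) y = (y == x) || has_cell L y.
Proof.
case: x y => [u a] [v b]; rewrite /has_cell ffunE xpair_eqE /=.
by case: eqP => //= _; rewrite !inE.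
Qed.

Lemma has_rem L x y : has_cell (symbol_rem L x.1 x.2) y = (y != x) && has_cell L y.
Proof.
case: x y => [u a] [v b]; rewrite /has_cell ffunE xpair_eqE /=.
by case: eqP => //= _; rewrite !inE.
Qed.

Lemma tup_ext L1 L2 : has_cell L1 =1 has_cell L2 -> L1 = L2.
Proof. by move=> eqL; apply/ffunP => u; apply/setP => a; apply: (eqL (u, a)). Qed.

Lemma add_remK L x : has_cell L x -> add_cell (symbol_rem L x.1 x.2) x = L.
Proof.
move=> Lx; apply: tup_ext => y; rewrite has_add has_rem.
by case: eqP => // ->; rewrite Lx.
Qed.

Lemma rem_addK L x : ~~ has_cell L x -> symbol_rem (add_cell L x) x.1 x.2 = L.
Proof.
move=> Lx; apply: tup_ext => y; rewrite has_rem has_add.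
by case: eqP => // ->; rewrite (negPf Lx).
Qed.

Lemma add_cellC L x y : add_cell (add_cell L x) y = add_cell (add_cell L y) x.
Proof. by apply: tup_ext => z; rewrite !has_add orbCA. Qed.

Lemma sigma_add L x y : ~~ has_cell L x ->
  sigma (add_cell L x) y.1 y.2 = (cell_lt x y + sigma L y.1 y.2)%N.
Proof.
move=> Lx; rewrite /sigma (cardsD1 x) inE -/(has_cell (add_cell L x) x) has_add eqxx /=.
congr (_ + _)%N; apply: eq_card => z; rewrite !inE -!/(has_cell _ z) has_add.
by case: eqP => //= ->; rewrite (negPf Lx).
Qed.

Lemma csign_add L x y : ~~ has_cell L x ->
  csign (add_cell L x) y = (-1) ^+ cell_lt x y * csign L y.
Proof. by move=> Lx; rewrite /csign sigma_add // exprD. Qed.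

(** Adding a second cell shifts the sign of exactly one of two cells, the larger
    one. *)
Lemma csign_anti L x y : x != y -> ~~ has_cell L x -> ~~ has_cell L y ->
  csign L x * csign (add_cell L x) y = - (csign L y * csign (add_cell L y) x).
Proof.
move=> ne Lx Ly; rewrite !csign_add // (cell_ltNge ne).
by case: (cell_lt y x); rewrite /= !(expr0, expr1, mul1r, mulN1r) !(mulrN, opprK) mulrC.
Qed.

Lemma csign_sqr L x : csign L x * csign L x = 1.
Proof. by rewrite /csign -expr2 sqrr_sign. Qed.

Definition nonempty L := [forall u, L u != set0].

(** Chains are coefficient functions, so the coefficient at [L] collects the tuples
    that become [L] when one cell is removed; the condition on [L x.1] says that
    the removal empties no set. *)
Definition bdry c L : K :=
  \sum_(x | ~~ has_cell L x && (L x.1 != set0)) csign L x * c (add_cell L x).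

Lemma add_neq0 L x u : (add_cell L x u != set0) = (u == x.1) || (L u != set0).
Proof.
rewrite ffunE; case: (u =P x.1) => [->|] //=; apply/set0Pn; exists x.2.
by rewrite !inE eqxx.
Qed.

Lemma bdry0 c L : (forall L1, c L1 = 0) -> bdry c L = 0.
Proof. by move=> c0; rewrite /bdry big1 // => x _; rewrite c0 mulr0. Qed.

Lemma eq_bdry c1 c2 : c1 =1 c2 -> bdry c1 =1 bdry c2.
Proof. by move=> eqc L; apply: eq_bigr => x _; rewrite eqc. Qed.

Lemma bdryB c1 c2 L : bdry (fun L => c1 L - c2 L) L = bdry c1 L - bdry c2 L.
Proof. by rewrite /bdry -sumrB; apply: eq_bigr => x _; rewrite mulrBr. Qed.

Lemma bdryD c1 c2 L : bdry (fun L => c1 L + c2 L) L = bdry c1 L + bdry c2 L.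
Proof. by rewrite /bdry -big_split; apply: eq_bigr => x _; rewrite mulrDr. Qed.

Lemma bdry_bdry c L : bdry (bdry c) L = 0.
Proof.
pose ok z := ~~ has_cell L z && (L z.1 != set0).
pose f x y : K := if [&& ok x, ok y & x != y] then
  csign L x * csign (add_cell L x) y * c (add_cell (add_cell L x) y) else 0.
transitivity (\sum_x \sum_y f x y); last first.
  apply: (sum_antisym cell_ltNge cell_lt_irr) => [x|x y]; rewrite /f.
    by rewrite eqxx !andbF.
  rewrite [in RHS]eq_sym andbCA; case: ifP => [/and3P[/andP[Lx _] /andP[Ly _] ne]|].
    by rewrite csign_anti // add_cellC mulNr.
  by rewrite oppr0.
rewrite /bdry big_mkcond; apply: eq_bigr => x _; case: ifPn => [okx|nokx]; last first.
  by rewrite big1 // => y _; rewrite /f /ok (negPf nokx).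
rewrite mulr_sumr big_mkcond; apply: eq_bigr => y _; rewrite /f {1}/ok okx /= mulrA.
congr (if _ then _ else _); rewrite has_add negb_or add_neq0 /ok [x == y]eq_sym.
have -> : (y.1 == x.1) || (L y.1 != set0) = (L y.1 != set0).
  by case: (y.1 =P x.1) => //= ->; case/andP: okx => _ ->.
by rewrite -andbA andbC.
Qed.

(** In a fixed multidegree every basis element of F_0 is sent by d_0 to the same
    monomial, so that d_0 becomes this sum. *)
Definition aug c : K := \sum_L c L.
Definition csize L : nat := (\sum_u #|L u|)%N.

Lemma csize_add L x : ~~ has_cell L x -> csize (add_cell L x) = (csize L).+1.
Proof.
move=> Lx; rewrite /csize (bigD1 x.1) //= [in RHS](bigD1 x.1) //= ffunE eqxx.
rewrite cardsU1 Lx add1n addSn; congr (_ + _).+1.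
by apply: eq_bigr => v /negPf ne; rewrite ffunE ne.
Qed.

Lemma csign_add_last L x : csign (add_cell L x) x = csign L x.
Proof.
have [Lx|Lx] := boolP (has_cell L x); last first.
  by rewrite csign_add // (negPf (cell_lt_irr x)) mul1r.
congr (csign _ _); apply: tup_ext => y; rewrite has_add.
by case: eqP => // ->.
Qed.

Lemma rem_neq0 L x : has_cell L x ->
  (symbol_rem L x.1 x.2 x.1 != set0) = (1 < #|L x.1|)%N.
Proof.
by move=> Lx; rewrite ffunE eqxx -card_gt0 (cardsD1 x.2 (L x.1)) -/(has_cell L x) Lx add1n.
Qed.

Lemma csign_block L u a b : L u = set0 -> csign L (u, a) = csign L (u, b).
Proof.
move=> Lu; congr (_ ^+ _); apply: eq_card => -[v e]; rewrite !inE /=.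
by have [->|ne] := eqVneq v u; rewrite ?Lu ?inE ?orbF.
Qed.

(** A tuple of nonempty sets of total size M + 1 consists of singletons and one pair, and
    the two ways of breaking the pair have opposite signs. *)
Lemma aug_bdry c :
    (forall L, c L != 0 -> nonempty L /\ csize L = M.+1) -> aug (bdry c) = 0.
Proof.
move=> c_supp; rewrite /aug /bdry (exchange_big_dep xpredT) //=.
transitivity (\sum_x \sum_(L | has_cell L x && (1 < #|L x.1|)%N)
    csign (symbol_rem L x.1 x.2) x * c L).
  apply: eq_bigr => x _.
  rewrite (reindex_onto (fun L => symbol_rem L x.1 x.2) (add_cell^~ x)) /=; last first.
    by move=> L /andP[Lx _]; rewrite rem_addK.
  rewrite (eq_bigl (fun L => has_cell L x && (1 < #|L x.1|)%N)) => [|L].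
    by apply: eq_bigr => L /andP[Lx _]; rewrite add_remK.
  rewrite has_rem eqxx /=; have [Lx|nLx] := boolP (has_cell L x).
    by rewrite rem_neq0 // add_remK // eqxx andbT.
  rewrite andbC; apply/negbTE; apply: contra nLx => /andP[/eqP <- _].
  by rewrite has_add eqxx.
rewrite (exchange_big_dep xpredT) //= big1 // => L _.
have [cL0|/c_supp[/forallP neL sizeL]] := eqVneq (c L) 0.
  by rewrite big1 // => x _; rewrite cL0 mulr0.
rewrite -mulr_suml [X in X * _](_ : _ = 0) ?mul0r //.
have L_gt0 v : (0 < #|L v|)%N by rewrite card_gt0.
(* The sets have total size M + 1, so their excesses over 1 sum to 1. *)
have /eqP/sum_nat_eq1[u [_ Lu Lne]] : (\sum_v (#|L v|).-1 = 1)%N.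
  have : (\sum_v (#|L v|.-1 + 1) = M.+1)%N.
    by rewrite -sizeL; apply: eq_bigr => v _; rewrite addn1 prednK.
  rewrite big_split /= sum_nat_const card_ord muln1 -add1n.
  by move/eqP; rewrite eqn_add2r => /eqP.
have {}Lu : #|L u| = 2 by rewrite -(prednK (L_gt0 u)) Lu.
have /cards2P[a [b [ne_ab Lab]]] : #|L u| == 2 by apply/eqP.
have inL e : has_cell L (u, e) = (e == a) || (e == b) by rewrite /has_cell Lab !inE.
rewrite (bigD1 (u, a)) /=; last by rewrite inL eqxx Lu.
rewrite (bigD1 (u, b)) /=; last first.
  by rewrite inL eqxx orbT Lu xpair_eqE eqxx eq_sym ne_ab.
rewrite big1 ?addr0 => [|[v e]]; last first.
  have [->|ne_v] := eqVneq v u.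
    by rewrite inL Lu !xpair_eqE eqxx /=; do 2 case: (e == _).
  have /eqP := Lne v ne_v isT.
  by rewrite -subn1 subn_eq0 leqNgt => /negPf ->; rewrite andbF.
have neab : (u, a) != (u, b) by rewrite xpair_eqE negb_and ne_ab orbT.
(* Both terms arise from the tuple L2 without the pair, whose set at u is empty. *)
pose L2 := symbol_rem (symbol_rem L u a) u b.
have L2u : L2 u = set0.
  by rewrite /L2 !ffunE eqxx Lab; apply/setP => e; rewrite !inE; do 2 case: (e == _).
have -> : symbol_rem L u a = add_cell L2 (u, b).
  by rewrite (@add_remK _ (u, b)) // (@has_rem _ (u, a)) inL eqxx orbT xpair_eqE eqxx eq_sym ne_ab.
have -> : symbol_rem L u b = add_cell L2 (u, a).
  apply: tup_ext => z; rewrite has_add /L2 !(has_rem _ (u, b)) (has_rem _ (u, a)).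
  by case: (z =P (u, a)) => [->|//]; rewrite inL eqxx neab.
have L2e e : ~~ has_cell L2 (u, e) by rewrite /has_cell L2u inE.
have /eqP := csign_anti neab (L2e a) (L2e b).
rewrite (csign_block a b L2u) -mulrN => /eqP/(mulfI _) -> //; first by rewrite subrr.
by rewrite signr_eq0.
Qed.

Section Acyclic.
Variable V : pred tup.
Hypothesis V_nonempty : forall L, V L -> nonempty L.
Hypothesis V_face : forall L x,
  ~~ has_cell L x -> L x.1 != set0 -> V (add_cell L x) -> V L.
Hypothesis V_cone : forall (u : 'I_M) b L L0, V L -> V L0 ->
  (forall v : 'I_M, (u < v)%N -> L v = L0 v) -> b \in L0 u ->
  (forall a, a \in L u -> (a <= b)%N) -> V (add_cell L (u, b)).

Definition supported s c := forall L, c L != 0 -> V L /\ csize L = s.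

Section Cone.
Variables (u : 'I_M) (b : 'I_n).
Let x0 : cell := (u, b).

Definition cone c L : K :=
  if has_cell L x0 then csign L x0 * c (symbol_rem L u b) else 0.

(** Wherever removing [b] from [L u] does not empty it, coning is a contracting
    homotopy on cycles: the terms of the boundary of the cone that keep [b] cancel
    against the cone of the boundary, which vanishes. *)
Lemma bdry_cone c L : (forall L, c L != 0 -> nonempty L) ->
  bdry c =1 (fun=> 0) -> L u != [set b] -> bdry (cone c) L = c L.
Proof.
move=> c_ne c_cycle Lu; have [Lx0|Lx0] := boolP (has_cell L x0); last first.
  have termE x : ~~ has_cell L x -> x != x0 -> cone c (add_cell L x) = 0.
    by move=> Lx ne; rewrite /cone has_add eq_sym (negPf ne) (negPf Lx0).
  have [Lu0|Lu0] := eqVneq (L u) set0.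
    have -> : c L = 0.
      by apply/eqP; apply: contraTT isT => /c_ne/forallP/(_ u); rewrite Lu0 eqxx.
    rewrite /bdry big1 // => x /andP[Lx Lx1]; rewrite termE ?mulr0 //.
    by apply: contraNneq Lx1 => ->; rewrite Lu0.
  rewrite /bdry (bigD1 x0) /=; last by rewrite Lx0.
  rewrite big1 ?addr0 => [|x /andP[/andP[Lx _] ne]]; last by rewrite termE ?mulr0.
  by rewrite /cone has_add eqxx /= csign_add_last (rem_addK Lx0) mulrA csign_sqr mul1r.
pose L' := symbol_rem L u b.
have LE : add_cell L' x0 = L by apply: (add_remK Lx0).
have L'x0 : ~~ has_cell L' x0 by rewrite (has_rem _ x0) eqxx.
have L'u : L' u != set0.
  rewrite (rem_neq0 Lx0) ltnNge; apply: contra Lu => le1.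
  by rewrite eq_sym eqEcard sub1set -/(has_cell L x0) Lx0 cards1.
have := c_cycle L'; rewrite /bdry (bigD1 x0) /=; last by rewrite L'x0.
rewrite LE => /eqP; rewrite addr_eq0 => /eqP cL.
have -> : c L = - csign L' x0 * \sum_(x | ~~ has_cell L' x && (L' x.1 != set0) && (x != x0))
    csign L' x * c (add_cell L' x).
  by rewrite mulNr -mulrN -cL mulrA csign_sqr mul1r.
rewrite mulr_sumr /bdry; apply: eq_big => [x|x /andP[Lx _]].
  rewrite -{1 2}LE has_add negb_or add_neq0.
  have -> : (x.1 == x0.1) || (L' x.1 != set0) = (L' x.1 != set0).
    by rewrite /x0 /=; case: (x.1 =P u) => //= ->; rewrite L'u.
  by rewrite -andbA andbC.
have /andP[ne L'x] : (x != x0) && ~~ has_cell L' x by rewrite -negb_or -has_add LE.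
rewrite /cone has_add Lx0 orbT.
have -> : symbol_rem (add_cell L x) u b = add_cell L' x.
  by rewrite -LE add_cellC (@rem_addK _ x0) // has_add negb_or eq_sym ne.
rewrite !mulrA; congr (_ * _).
have -> : csign (add_cell L x) x0 = csign (add_cell L' x) x0.
  by rewrite -LE add_cellC csign_add_last.
rewrite eq_sym in ne; have := csign_anti ne L'x0 L'x; rewrite LE => anti.
have -> : csign L x = - (csign L' x0 * csign L' x * csign (add_cell L' x) x0).
  by rewrite -mulrA -mulrN -anti mulrA csign_sqr mul1r.
by rewrite !mulNr -(mulrA (csign L' x0 * csign L' x)) csign_sqr mulr1.
Qed.

End Cone.

Definition rigid (r : nat) c := forall L1 L2, c L1 != 0 -> c L2 != 0 ->
  forall v : 'I_M, (r <= v)%N -> L1 v = L2 v /\ #|L1 v| = 1%N.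

(** Induction on the number of indices that still vary.  Subtracting the boundary
    of the cone over the largest available element makes one more index rigid; a
    chain that is rigid everywhere is a multiple of one tuple of singletons. *)
Lemma rigid_bounds s r c : (r <= M)%N -> supported s c -> rigid r c ->
    bdry c =1 (fun=> 0) -> (s = M -> aug c = 0) ->
  exists2 c', supported s.+1 c' & bdry c' =1 c.
Proof.
elim: r c => [|r IHr] c le_rM c_supp c_rigid c_cycle c_aug.
  exists (fun=> 0) => [L|L]; first by rewrite eqxx.
  rewrite bdry0 //; apply/esym/eqP; apply: contraTT isT => cL.
  have only L1 : c L1 != 0 -> L1 = L.
    by move=> cL1; apply/ffunP => v; case: (c_rigid _ _ cL1 cL v).
  have sM : s = M.
    have [_ <-] := c_supp _ cL; rewrite /csize (eq_bigr (fun=> 1%N)) => [|v _].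
      by rewrite sum1_card card_ord.
    by case: (c_rigid _ _ cL cL v).
  have := c_aug sM; rewrite /aug (bigD1 L) //= big1 => [|L1 ne].
    by rewrite addr0 => c0; rewrite c0 eqxx in cL.
  by apply/eqP; apply: contraNT ne => /only ->.
have [z cz|c0] := pickP (fun L => c L != 0); last first.
  exists (fun=> 0) => [L|L]; first by rewrite eqxx.
  by rewrite bdry0 //; apply/esym/eqP/negbFE/c0.
pose u : 'I_M := Ordinal le_rM.
have c_ne L : c L != 0 -> nonempty L by case/c_supp => /V_nonempty.
have [a za] : exists a, a \in z u by apply/set0Pn; move/forallP: (c_ne _ cz).
(* The apex: the largest element that occurs at u on the support of c. *)
have [[L0 b] /=] := @arg_maxnP _ (z, a)
  (fun w : tup * 'I_n => (c w.1 != 0) && (w.2 \in w.1 u))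
  (fun w => w.2 : nat) (introT andP (conj cz za)).
move=> /andP[cL0 L0b] b_max.
have cone_supp L : cone u b c L != 0 ->
    [/\ c (symbol_rem L u b) != 0, V L & csize L = s.+1].
  rewrite /cone; case: ifP => [Lx|]; last by rewrite eqxx.
  rewrite mulf_eq0 negb_or => /andP[_ cL1]; have [VL1 sL1] := c_supp _ cL1.
  have nL1 : ~~ has_cell (symbol_rem L u b) (u, b) by rewrite (has_rem _ (u, b)) eqxx.
  have LE : add_cell (symbol_rem L u b) (u, b) = L by apply: (add_remK Lx).
  split=> //; rewrite -LE; last by rewrite csize_add // sL1.
  apply: (V_cone VL1 (proj1 (c_supp _ cL0))) => // [v lt_uv|e L1e].
    by case: (c_rigid _ _ cL1 cL0 v).
  by apply: (b_max (symbol_rem L u b, e)); rewrite /= cL1.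
pose c1 L := c L - bdry (cone u b c) L.
have c1_supp L : c1 L != 0 -> [/\ V L, csize L = s, L u = [set b]
    & exists2 L2, c L2 != 0 & forall v : 'I_M, (u < v)%N -> L v = L2 v].
  move=> c1L; have Lu : L u = [set b].
    apply/eqP; apply: contraNT c1L => Lu.
    by rewrite /c1 bdry_cone // subrr.
  have [cL|cL] := eqVneq (c L) 0; last by have [VL sL] := c_supp _ cL; split=> //; exists L.
  have [x /andP[/andP[Lx Lx1] hx]|h0] := pickP (fun x => ~~ has_cell L x && (L x.1 != set0)
      && (cone u b c (add_cell L x) != 0)); last first.
    case/eqP: c1L; rewrite /c1 cL sub0r /bdry big1 ?oppr0 // => x okx.
    by have := h0 x; rewrite okx /= => /negbFE/eqP ->; rewrite mulr0.
  have [c2 VLx sLx] := cone_supp _ hx.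
  split=> //; first exact: V_face Lx Lx1 VLx.
    by apply: succn_inj; rewrite -(csize_add Lx).
  exists (symbol_rem (add_cell L x) u b) => // v lt_uv.
  have ne_vu : v != u by rewrite -val_eqE /= gtn_eqF.
  have [_] := c_rigid _ _ c2 c2 v lt_uv; rewrite !ffunE (negPf ne_vu).
  case: (v =P x.1) => // -> ; rewrite cardsU1 Lx add1n => -[] /eqP.
  by rewrite cards_eq0 (negPf Lx1).
have [| | | |c1' c1'_supp c1'E] := IHr c1 (ltnW le_rM).
- by move=> L /c1_supp[].
- move=> L1 L2 /c1_supp[_ _ L1u [L3 cL3 L3E]] /c1_supp[_ _ L2u [L4 cL4 L4E]] v.
  rewrite leq_eqVlt => /predU1P[eq_uv|lt_uv].
    have -> : v = u by apply: val_inj.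
    by rewrite L1u L2u cards1.
  have [eqv cardv] := c_rigid _ _ cL3 cL4 v lt_uv.
  by rewrite (L3E v lt_uv) (L4E v lt_uv).
- by move=> L; rewrite /c1 bdryB c_cycle bdry_bdry subrr.
- move=> sM; rewrite /aug sumrB -!/(aug _) c_aug // aug_bdry ?subrr // => L /cone_supp[_ VL ->].
  by rewrite sM; split=> //; apply: V_nonempty.
exists (fun L => cone u b c L + c1' L) => [L|L]; last by rewrite bdryD c1'E /c1 addrC subrK.
have [c10|/c1'_supp //] := eqVneq (c1' L) 0; rewrite c10 addr0.
by case/cone_supp.
Qed.

Lemma cycle_bounds s c : supported s c -> bdry c =1 (fun=> 0) ->
  (s = M -> aug c = 0) -> exists2 c', supported s.+1 c' & bdry c' =1 c.
Proof.
move=> c_supp; apply: (@rigid_bounds _ M) => // L1 L2 _ _ v.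
by rewrite leqNgt ltn_ord.
Qed.

End Acyclic.

End Chains.

(** * The diagonal specialization on monomials *)

Section Variables.
Variables (n : nat) (d : Order.disp_t) (Q : finPOrderType d) (B : Q -> {set 'I_n}).

Lemma XdegE x a i : Xdeg B x a i = (pvar_val i == (x, a)) :> nat.
Proof. by rewrite /Xdeg mnmE. Qed.

Lemma Xdeg_out x a : a \notin B x -> Xdeg B x a = 0%MM.
Proof.
move=> nBa; apply/mnmP => i; rewrite XdegE mnm0E; case: eqP => // ei.
by have := valP (enum_val i); rewrite /= -/(pvar_val i) ei (negPf nBa).
Qed.

Lemma Xdeg_in x a : a \in B x -> exists2 i, pvar_val i = (x, a) & Xdeg B x a = U_(i)%MM.
Proof.
move=> Ba; pose v : pvar B := Sub (x, a) (Ba : (x, a).2 \in B (x, a).1).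
exists (enum_rank v); first by rewrite /pvar_val enum_rankK.
apply/mnmP => i; rewrite XdegE mnm1E; congr (nat_of_bool _).
by rewrite -(inj_eq enum_val_inj) enum_rankK eq_sym -val_eqE.
Qed.

Lemma pvar_inj : injective (@pvar_val n d Q B).
Proof. by move=> i j /val_inj/enum_val_inj. Qed.

Lemma Xdeg_pvar i : Xdeg B (pvar_val i).1 (pvar_val i).2 = U_(i)%MM.
Proof.
apply/mnmP => j; rewrite XdegE mnm1E -surjective_pairing (inj_eq pvar_inj).
by rewrite eq_sym.
Qed.

End Variables.

HB.instance Definition _ (K : fieldType) (n k : nat) (d : Order.disp_t)
    (P : finPOrderType d) (A : P -> {set 'I_n}) :=
  GRing.RMorphism.copy (diag_map K k A) (comp_mpoly _).

Section Diagonal.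
Variables (K : fieldType) (n k : nat) (d : Order.disp_t).
Variables (P : finPOrderType d) (A : P -> {set 'I_n}).
Local Notation rho := (diag_map K k A).
Local Notation rhodeg := (diag_deg k A).

Lemma diag_degD : {morph rhodeg : m1 m2 / (m1 + m2)%MM}.
Proof.
move=> m1 m2; rewrite /diag_deg -big_split; apply: eq_bigr => i _.
by apply/mnmP => j; rewrite !(mnmDE, mulmnE) mulnDr.
Qed.

Lemma diag_deg0 : rhodeg 0%MM = 0%MM.
Proof. by rewrite /diag_deg big1 // => i _; rewrite mnm0E mulm0n. Qed.

Lemma diag_degX x a : rhodeg (Xdeg (pow_map A) x a) = Xdeg A x.1 a.
Proof.
have [Aa|nAa] := boolP (a \in pow_map (k := k) A x); last first.
  by rewrite !Xdeg_out // diag_deg0.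
have [i ei ->] := Xdeg_in Aa; rewrite /diag_deg (bigD1 i) //= mnm1E eqxx mulm1n ei.
by rewrite big1 ?addm0 // => j ne; rewrite mnm1E eq_sym (negPf ne) mulm0n.
Qed.

Lemma diag_mapX m : rho 'X_[m] = 'X_[rhodeg m].
Proof.
rewrite /diag_map comp_mpolyX /diag_deg -mprodXnE.
by apply: eq_bigr => i _; rewrite tnth_mktuple.
Qed.

Lemma diag_mapZ c p : rho (c *: p) = c *: rho p.
Proof. exact: comp_mpolyZ. Qed.

Lemma diag_map_Xvar x a : rho (Xvar K (pow_map A) x a) = Xvar K A x.1 a.
Proof. by rewrite diag_mapX diag_degX. Qed.

Lemma diag_map_supp p m : m \in msupp (rho p) ->
  exists2 m', m' \in msupp p & m = rhodeg m'.
Proof.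
rewrite {1}[p]mpolyE rmorph_sum /= => /msupp_sum_le/flatten_mapP[m' pm'].
rewrite diag_mapZ diag_mapX => /msuppZ_le; rewrite msuppX inE => /eqP ->.
by exists m' => //; move: pm'; rewrite mem_filter.
Qed.

End Diagonal.

(** * Admissible tuples *)

Section Symbols.
Variables (K : fieldType) (n k : nat) (d : Order.disp_t).
Variables (P : finPOrderType d) (A : P -> {set 'I_n}).
Local Notation M := (#|P| * k)%N.
Variable q : 'I_M -> pow_poset k P.
Hypothesis q_bij : bijective q.
Hypothesis q_linear : forall u v, (q u < q v)%O -> (u < v)%N.
Local Notation tup := {ffun 'I_M -> {set 'I_n}}.
Local Notation cell := ('I_M * 'I_n)%type.
Local Notation mon := 'X_{1..#|pvar A|}.
Implicit Types (L : tup).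

Definition ordered L :=
  [forall u, forall v, (q u < q v)%O ==>
     [forall a in L u, forall b in L v, (a <= b)%N]].

Lemma orderedP L : reflect
  (forall u v a b, (q u < q v)%O -> a \in L u -> b \in L v -> (a <= b)%N) (ordered L).
Proof.
apply: (iffP idP) => [/forallP ord u v a b lt Lu Lv|ord].
  move/forallP: (ord u) => /(_ v)/implyP/(_ lt)/forall_inP/(_ a Lu).
  by move/forall_inP/(_ b Lv).
apply/forallP => u; apply/forallP => v; apply/implyP => lt.
by apply/forall_inP => a Lu; apply/forall_inP => b Lv; apply: (ord u v).
Qed.

Definition admissible L :=
  [forall u, (L u != set0) && (L u \subset pow_map A (q u))] && ordered L.

Lemma admissible_sub L u : admissible L -> L u \subset A (q u).1.
Proof. by case/andP=> /forallP/(_ u)/andP[]. Qed.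

Lemma admissible_nonempty L : admissible L -> nonempty L.
Proof. by case/andP=> /forallP sL _; apply/forallP => u; case/andP: (sL u). Qed.

(** The isotone map in the definition of a symbol comes for free: if
    max K_u <= min K_v, then max K_u <= max K_v because K_v is nonempty. *)
Lemma is_symbolE t L :
  is_symbol (pow_map A) q t L = admissible L && (csize L == M + t)%N.
Proof.
apply/and4P/andP => [[sL sizeL ordL _]|[admL sizeL]].
  by rewrite /admissible sL; split.
have [sL ordL] := andP admL; split=> //.
have [q' qK q'K] := q_bij.
have max_ex x : exists a, (a \in L (q' x)) && [forall b in L (q' x), (b <= a)%N].
  have /set0Pn[a0 La0] : L (q' x) != set0 by move/forallP: (admissible_nonempty admL).
  have [a La a_max] := @arg_maxnP _ a0 (mem (L (q' x))) (fun a => a : nat) La0.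
  by exists a; apply/andP; split=> //; apply/forall_inP => b /a_max.
have [f fP] := fin_all_exists max_ex.
have fL x : f x \in L (q' x) by case/andP: (fP x).
apply/exists_inP; exists [ffun x => f x]; last first.
  apply/forallP => u; rewrite ffunE; move: (fP (q u)); rewrite qK => /andP[-> /forall_inP fmax].
  by apply/forall_inP.
rewrite inE; apply/andP; split; last first.
  apply/forallP => x; rewrite ffunE -{2}[x]q'K.
  by apply: (subsetP (admissible_sub _ admL)).
apply/forallP => x; apply/forallP => y; apply/implyP; rewrite !ffunE le_eqVlt.
case/predU1P=> [->//|lt_xy]; apply: (orderedP _ ordL (q' x) (q' y)) => //.
by rewrite !q'K.
Qed.

(** The multidegree of a symbol over R, after the specialization. *)
Definition tdeg L : mon := diag_deg k A (symbol_deg (pow_map A) q L).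

Lemma tdeg_sum L : tdeg L = (\sum_u \sum_(a in L u) Xdeg A (q u).1 a)%MM.
Proof.
rewrite /tdeg /symbol_deg (big_morph _ (@diag_degD _ _ _ _ A) (@diag_deg0 _ _ _ _ A)).
apply: eq_bigr => u _; rewrite (big_morph _ (@diag_degD _ _ _ _ A) (@diag_deg0 _ _ _ _ A)).
by apply: eq_bigr => a _; rewrite diag_degX.
Qed.

Lemma tdegE L i : tdeg L i
  = #|[set u | ((q u).1 == (pvar_val i).1) && ((pvar_val i).2 \in L u)]|.
Proof.
rewrite tdeg_sum mnm_sumE -sum1dep_card [RHS]big_mkcond; apply: eq_bigr => u _ /=.
rewrite mnm_sumE (eq_bigr (fun a => (((q u).1 == (pvar_val i).1) && ((pvar_val i).2 == a) : nat))).
  have [Lu|Lu] := boolP ((pvar_val i).2 \in L u).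
    rewrite (bigD1 _ Lu) /= eqxx andbT big1 ?addn0 => [|a /andP[_ /negPf ne]]; first by case: eqP.
    by rewrite [_.2 == a]eq_sym ne andbF.
  rewrite andbF big1 // => a La; case: eqP => //= _; case: eqP => // eqa.
  by rewrite eqa La in Lu.
move=> a _; rewrite XdegE {1}[pvar_val i]surjective_pairing xpair_eqE.
by rewrite [_.1 == _.1]eq_sym.
Qed.

Lemma tdeg_add L x : ~~ has_cell L x ->
  tdeg (add_cell L x) = (Xdeg A (q x.1).1 x.2 + tdeg L)%MM.
Proof.
move=> Lx; rewrite !tdeg_sum (bigD1 x.1) //= [in RHS](bigD1 x.1) //= addmA; congr (_ + _)%MM.
  by rewrite ffunE eqxx big_setU1.
by apply: eq_bigr => v /negPf ne; rewrite ffunE ne.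
Qed.

Definition admissible_le (mu : mon) L := admissible L && (tdeg L <= mu)%MM.

Lemma admissible_face L x : ~~ has_cell L x -> L x.1 != set0 ->
  admissible (add_cell L x) -> admissible L.
Proof.
move=> Lx Lx1 /andP[/forallP sLx /orderedP ordLx]; apply/andP; split.
  apply/forallP => v; have := sLx v; rewrite ffunE; case: (v =P x.1) => [->|//].
  by rewrite Lx1 => /andP[_]; apply: subset_trans; apply: subsetUr.
have inLx v a : a \in L v -> a \in add_cell L x v.
  by move=> Lv; rewrite ffunE; case: ifP => // _; rewrite inE Lv orbT.
by apply/orderedP => u v a b lt /inLx La /inLx Lb; apply: (ordLx u v).
Qed.

Lemma admissible_le_face mu L x : ~~ has_cell L x -> L x.1 != set0 ->
  admissible_le mu (add_cell L x) -> admissible_le mu L.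
Proof.
move=> Lx Lx1 /andP[/(admissible_face Lx Lx1) admL degL]; rewrite /admissible_le admL.
by apply: lepm_trans degL; rewrite tdeg_add // lem_addl.
Qed.

(** Only the exponent of X_(p,b), with p the component of [q u], can exceed the
    degree bound.  If [b] is not yet in [L u], it lies in no set [L v] with
    [q v < q u], as it would then be at most every element of [L u], which are
    all at most [b].  So the other occurrences of [b] over p are at later indices,
    where [L] agrees with [L0]; and [L0 u] contains [b], too. *)
Lemma admissible_le_cone mu (u : 'I_M) b L L0 :
    admissible_le mu L -> admissible_le mu L0 ->
    (forall v : 'I_M, (u < v)%N -> L v = L0 v) -> b \in L0 u ->
    (forall a, a \in L u -> (a <= b)%N) ->
  admissible_le mu (add_cell L (u, b)).
Proof.
move=> /andP[admL degL] /andP[admL0 degL0] eqL L0b Lb.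
have [Lub|nLub] := boolP (b \in L u).
  rewrite (_ : add_cell L (u, b) = L) ?/admissible_le ?admL //.
  by apply: tup_ext => x; rewrite has_add; case: eqP => // ->.
have /orderedP ordL : ordered L by case/andP: admL.
have /orderedP ordL0 : ordered L0 by case/andP: admL0.
have /set0Pn[a Lua] : L u != set0 by move/forallP: (admissible_nonempty admL).
have addE v e : e \in add_cell L (u, b) v -> (v = u /\ e = b) \/ e \in L v.
  by rewrite ffunE /=; case: (v =P u) => [->|_]; [rewrite !inE => /predU1P[]|]; auto.
apply/andP; split; first (apply/andP; split).
- apply/forallP => v; have /forallP/(_ v) := admissible_nonempty admL => nLv.
  rewrite add_neq0 nLv orbT; apply/subsetP => e /addE[[-> ->]|].
    by apply: (subsetP (admissible_sub u admL0)).
  by apply: (subsetP (admissible_sub v admL)).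
- apply/orderedP => v w e f lt_vw /addE[[ev ->]|Lve] /addE[[ew ef]|Lwf].
  + by rewrite ev ew ltxx in lt_vw.
  + rewrite ev in lt_vw; have Lw := eqL w (q_linear lt_vw).
    by apply: (ordL0 u w) => //; rewrite -Lw.
  + rewrite ef; rewrite ew in lt_vw.
    by apply: leq_trans (Lb a Lua); apply: (ordL v u).
  + exact: ordL lt_vw Lve Lwf.
apply/mnm_lepP => i; have [ei|ne_i] := boolP (pvar_val i == ((q u).1, b)); last first.
  apply: leq_trans (mnm_lepP degL i); rewrite tdeg_add //= mnmDE XdegE.
  by rewrite (negPf ne_i).
apply: leq_trans (mnm_lepP degL0 i); rewrite !tdegE (eqP ei) /=.
apply/subset_leq_card/subsetP => v; rewrite !inE => /andP[/eqP qv].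
rewrite qv eqxx /= => /addE[[-> _]//|Lvb].
have [lt_uv|le_vu] := ltnP u v; first by rewrite -eqL.
have [eq_vu|ne_vu] := eqVneq v u; first by rewrite eq_vu.
(* Elements of P^k with the same component in P are comparable. *)
have lt_q : (q v < q u)%O.
  have : (q v >=< q u)%O.
    rewrite /Order.comparable !Order.ProdOrder.leEprod qv lexx /=.
    exact: Order.TotalTheory.le_total.
  case/comparable_ltgtP => // [/q_linear|/(bij_inj q_bij) eq_vu].
    by rewrite ltnNge le_vu.
  by rewrite eq_vu eqxx in ne_vu.
have eq_ab : a = b.
  by apply/val_inj/eqP; rewrite eqn_leq Lb // (ordL v u b a lt_q Lvb Lua).
by rewrite -eq_ab Lua in nLub.
Qed.

End Symbols.

(** * The specialized resolution and its exactness *)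

Definition base_change (K : fieldType) (NT NR : nat)
    (rho : {mpoly K[NT]} -> {mpoly K[NR]}) (rhodeg : 'X_{1..NT} -> 'X_{1..NR})
    (F : mfcomplex K NT) : mfcomplex K NR :=
  @MFComplex K NR (cbasis F) (fun t e => rhodeg (cmdeg e))
    (fun e => rho (cd0 e)) (fun t e => [ffun f => rho (cd e f)]).

Section Differential.
Variables (K : fieldType) (n k : nat) (d : Order.disp_t).
Variables (P : finPOrderType d) (A : P -> {set 'I_n}).
Local Notation M := (#|P| * k)%N.
Variable q : 'I_M -> pow_poset k P.
Hypothesis q_bij : bijective q.
Hypothesis q_linear : forall u v, (q u < q v)%O -> (u < v)%N.
Local Notation tup := {ffun 'I_M -> {set 'I_n}}.
Local Notation cell := ('I_M * 'I_n)%type.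
Local Notation mon := 'X_{1..#|pvar A|}.
Local Notation S := {mpoly K[#|pvar A|]}.
Implicit Types (L : tup) (x : cell).

Definition power_resolution : mfcomplex K #|pvar A| :=
  base_change (diag_map K k A) (diag_deg k A)
    (letterplace_resolution K (pow_map A) q).
Local Notation G := power_resolution.
Local Notation sym := (symbol (pow_map A) q).
Local Notation sdeg := (fun e => tdeg A q (val e)).

Lemma cd0_power (e : cbasis G 0) : cd0 e = 'X_[tdeg A q (val e)].
Proof.
rewrite /= /symbol_d0 rmorph_prod tdeg_sum -mprodXE; apply: eq_bigr => u _.
rewrite rmorph_prod -mprodXE; apply: eq_bigr => a _; exact: diag_map_Xvar.
Qed.

Lemma cd_power t (e : sym t.+1) (f : sym t) : (@cd _ _ G t e f : S) =
  \sum_(x | has_cell (val e) x && (1 < #|val e x.1|)%N)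
    (if val f == symbol_rem (val e) x.1 x.2
     then csign K (val e) x *: Xvar K A (q x.1).1 x.2 else 0).
Proof.
rewrite ffunE /= /symbol_d pair_big_dep /= sum_ffunE rmorph_sum.
apply: eq_bigr => x _; rewrite !ffunE -[_ *: _]/(_ * _) !rmorphM rmorph_nat rmorph_sign.
rewrite /= diag_map_Xvar; case: eqP => _; last by rewrite mulr0.
by rewrite mulr1 /csign -mul_mpolyC rmorph_sign.
Qed.

Lemma tdeg_rem L x : has_cell L x ->
  tdeg A q L = (Xdeg A (q x.1).1 x.2 + tdeg A q (symbol_rem L x.1 x.2))%MM.
Proof.
by move=> Lx; rewrite -{1}(add_remK Lx) tdeg_add // has_rem eqxx.
Qed.

Lemma cd_power_mdeg t (e : sym t.+1) :
  has_mdeg (fun f : sym t => tdeg A q (val f)) (tdeg A q (val e)) (@cd _ _ G t e).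
Proof.
move=> f m; rewrite cd_power => /msupp_sum_le/flatten_mapP[x].
rewrite mem_filter => /andP[/andP[ex _] _]; case: eqP => [ef|]; last by rewrite msupp0.
by move/msuppZ_le; rewrite msuppX inE => /eqP ->; rewrite ef -tdeg_rem.
Qed.

Lemma power_multigraded : multigraded G.
Proof.
split=> [e m|t e]; last exact: cd_power_mdeg.
by rewrite cd0_power msuppX inE => /eqP.
Qed.

Lemma strand_cd_power t (e : sym t.+1) (f : sym t) :
  strand (fun f : sym t => tdeg A q (val f)) (tdeg A q (val e)) (@cd _ _ G t e) f
  = \sum_(x | has_cell (val e) x && (1 < #|val e x.1|)%N)
      (if val f == symbol_rem (val e) x.1 x.2 then csign K (val e) x else 0).
Proof.
rewrite /strand cd_power (@raddf_sum _ _ (mcoeff _)) /=.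
case: ifPn => [le_fe|nle_fe].
  apply: eq_bigr => x /andP[ex _]; case: eqP => [ef|]; last by rewrite mcoeff0.
  by rewrite (tdeg_rem ex) -ef addmK mcoeffZ mcoeffX eqxx mulr1.
rewrite big1 // => x /andP[ex _]; case: eqP => // ef.
by rewrite (tdeg_rem ex) -ef lem_addl in nle_fe.
Qed.

Definition ext t (c : sym t -> K) L : K :=
  if insub L is Some e then c e else 0.

Lemma ext_val t (c : sym t -> K) e : ext c (val e) = c e.
Proof. by rewrite /ext valK. Qed.

Lemma ext_out t (c : sym t -> K) L : ~~ is_symbol (pow_map A) q t L -> ext c L = 0.
Proof. by move=> nL; rewrite /ext insubN. Qed.

Lemma ext_neq0 t (c : sym t -> K) L : ext c L != 0 ->
  exists2 e, val e = L & c e != 0.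
Proof.
rewrite /ext; case: insubP => [e _ <- ce|]; last by rewrite eqxx.
by exists e.
Qed.

Lemma symbol_face t L x : ~~ has_cell L x -> L x.1 != set0 ->
  is_symbol (pow_map A) q t.+1 (add_cell L x) -> is_symbol (pow_map A) q t L.
Proof.
move=> Lx Lx1; rewrite !is_symbolE // => /andP[/(admissible_face Lx Lx1) ->].
by rewrite csize_add // addnS eqSS.
Qed.

(** In each multidegree the differential of the resolution is the boundary on
    tuples. *)
Lemma ext_bdry t mu (y : {ffun sym t.+1 -> S^o}) :
  ext (strand (fun f : sym t => tdeg A q (val f)) mu (cdiff G t y))
  =1 bdry (ext (strand (fun f : sym t.+1 => tdeg A q (val f)) mu y)).
Proof.
move=> L; have [symL|nsymL] := boolP (is_symbol (pow_map A) q t L); last first.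
  rewrite ext_out // /bdry big1 // => x /andP[Lx Lx1].
  by rewrite ext_out ?mulr0 //; apply: contra nsymL; apply: symbol_face.
pose f : sym t := Sub L symL; rewrite -[L]/(val f) ext_val.
apply: etrans (strand_lin_ext (@cd_power_mdeg t) mu y f) _.
under eq_bigr => e _ do rewrite strand_cd_power mulr_sumr.
rewrite (exchange_big_dep xpredT) //= /bdry [RHS]big_mkcond; apply: eq_bigr => x _.
rewrite (eq_bigr (fun e : sym t.+1 => if (val e == add_cell L x) && ~~ has_cell L x then
   csign K L x * strand (fun f : sym t.+1 => tdeg A q (val f)) mu y e else 0)); last first.
  move=> e /= /andP[ex _]; have [eqL|neL] := eqVneq L (symbol_rem (sval e) x.1 x.2).
    have nLx : ~~ has_cell L x by rewrite eqL has_rem eqxx.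
    have eE : sval e = add_cell L x by rewrite eqL add_remK.
    by rewrite eE eqxx nLx csign_add_last mulrC.
  rewrite mulr0; case: eqP => //= eE; case: ifP => // nLx.
  by rewrite eE rem_addK // eqxx in neL.
rewrite -big_mkcondr.
case: ifPn => [/andP[Lx Lx1]|okx]; last first.
  rewrite big1 // => e /andP[/andP[ex e1] /andP[/eqP eE Lx]].
  move: okx; rewrite Lx /= negbK => Lx1.
  by move: e1; rewrite eE ffunE eqxx (eqP Lx1) setU0 cards1.
have [symLx|nsymLx] := boolP (is_symbol (pow_map A) q t.+1 (add_cell L x)); last first.
  rewrite ext_out // mulr0 big1 // => e /andP[_ /andP[/eqP eE _]].
  by rewrite -eE (valP e) in nsymLx.
pose e0 : sym t.+1 := Sub _ symLx.
rewrite -[add_cell L x]/(val e0) ext_val (big_pred1 e0) // => e /=.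
rewrite Lx andbT -val_eqE /=; case: eqP => [->|]; last by rewrite andbF.
by rewrite has_add eqxx ffunE eqxx cardsU1 Lx add1n ltnS card_gt0 Lx1.
Qed.

Lemma cdiff0_coef mu (x : {ffun sym 0 -> S^o}) : (cdiff0 G x : S)@_mu
  = aug (ext (strand (fun f : sym 0 => tdeg A q (val f)) mu x)).
Proof.
have augE (c : sym 0 -> K) : aug (ext c) = \sum_e c e.
  rewrite /aug (bigID (is_symbol (pow_map A) q 0)) /= [X in _ + X]big1 ?addr0; last first.
    by move=> L nL; rewrite ext_out.
  rewrite (reindex_omap (val : sym 0 -> tup) insub) /= => [|L symL]; last by rewrite insubT.
  by apply: eq_big => [e|e _]; rewrite ?ext_val // (valP e) valK eqxx.
rewrite augE -[cdiff0 G x]/(\sum_(e : cbasis G 0) (x e : S) * (cd0 e : S))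
  (@raddf_sum _ _ (mcoeff _)).
apply: eq_bigr => e _; rewrite cd0_power /strand /=.
case: ifPn => [le_e|nle_e]; first by rewrite -{1}(submK le_e) addmC mcoeffMX.
apply: memN_msupp_eq0; apply: contra nle_e; rewrite (perm_mem (msuppMX _ _)).
by case/mapP=> m _ ->; rewrite lem_addr.
Qed.

(** Treats the augmentation d_0 and the differentials uniformly. *)
Definition is_cycle (N : nat) (F : mfcomplex K N) t : cterm F t -> Prop :=
  match t with 0 => fun z => cdiff0 F z = 0 | t.+1 => fun z => cdiff F t z = 0 end.

Lemma symbol_supported t mu (x : {ffun sym t -> S^o}) :
  supported (admissible_le q mu) (M + t)
    (ext (strand (fun f : sym t => tdeg A q (val f)) mu x)).
Proof.
move=> L /ext_neq0[e <-]; rewrite /strand; case: ifP => [le_e _|]; last by rewrite eqxx.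
have := valP e; rewrite is_symbolE // => /andP[adm /eqP sz].
by rewrite /admissible_le adm le_e.
Qed.

Lemma power_exact t (x : cterm G t) : is_cycle x <-> exists y, cdiff G t y = x.
Proof.
split=> [zx|[y <-]]; last first.
  case: t x y => [|t] _ y /=.
    apply/mpolyP => mu; rewrite mcoeff0 cdiff0_coef.
    rewrite -[RHS](@aug_bdry K _ _ (ext (strand (fun f : sym 1 => tdeg A q (val f)) mu y))).
      by apply: eq_bigr => L _; apply: ext_bdry.
    move=> L /symbol_supported[/andP[adm _] sz].
    by split; [exact: admissible_nonempty adm | rewrite sz addn1].
  apply: (@strand_inj _ _ _ (fun f : sym t => tdeg A q (val f))) => mu f.
  rewrite strand0 -ext_val ext_bdry (eq_bdry (ext_bdry mu y)).
  exact: bdry_bdry.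
(* The bounding chains must vanish together with c mu, to be nonzero in
     finitely many degrees only. *)
pose c mu := ext (strand (fun f : sym t => tdeg A q (val f)) mu x).
have c_bounds mu : exists c' : tup -> K, [/\ supported (admissible_le q mu) (M + t).+1 c',
    bdry c' =1 c mu & (forall L, c mu L = 0) -> forall L, c' L = 0].
  have [c0|nc0] := pselect (forall L, c mu L = 0).
    exists (fun=> 0); split=> [L|L|//]; first by rewrite eqxx.
    by rewrite c0 bdry0.
  have [|||||| c' c'supp c'E] := @cycle_bounds K M n (admissible_le q mu) _ _ _ (M + t) (c mu).
  - by move=> L /andP[/admissible_nonempty].
  - by move=> L y; apply: admissible_le_face.
  - by move=> u b L L0; apply: admissible_le_cone.
  - exact: symbol_supported.
  - case: t x zx @c {nc0} => [|t] x zx c L.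
      rewrite /bdry big1 // => y /andP[Ly Ly1].
      rewrite [c mu _](_ : _ = 0) ?mulr0 //; apply/eqP; apply: contraTT isT => cLy.
      have [/andP[/admissible_nonempty/forallP ne _] /eqP] := symbol_supported cLy.
      rewrite addn0 csize_add // => /eqP sz.
      (* A boundary of singletons vanishes, as removing an element would empty its set. *)
      have : (\sum_(u < M) 1 <= csize L)%N.
        apply: leq_sum => u _; rewrite card_gt0; have := ne u; rewrite add_neq0.
        by case: (u =P y.1) => [->|].
      by rewrite sum1_card card_ord -[X in (X <= _)%N]sz ltnn.
    by rewrite -ext_bdry zx /ext; case: insub => // e; apply: strand0.
  - case: t x zx @c {nc0} => [|t] x zx c sM.
      by rewrite -cdiff0_coef [cdiff0 G x]zx mcoeff0.
    by have /eqP := sM; rewrite -[X in _ == X]addn0 eqn_add2l.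
  by exists c'; split=> // /nc0.
have [c' c'E] := choice c_bounds.
have [l lP] := strand_finite (fun f : sym t => tdeg A q (val f)) x.
have [mu e nle|mu nl e|y yE] := @strand_glue K _ _ (fun f : sym t.+1 => tdeg A q (val f))
    (fun mu e => c' mu (val e)) l.
- have [supp_c' _ _] := c'E mu; apply/eqP; apply: contraNT nle => /supp_c'[/andP[_ ->]].
  by [].
- have [_ _ -> //] := c'E mu => L; rewrite /c /ext; case: insub => // f.
  exact: lP.
exists y; apply: (@strand_inj _ _ _ (fun f : sym t => tdeg A q (val f))) => mu f.
rewrite -[LHS]ext_val ext_bdry -[RHS]ext_val -/(c mu).
have [supp_c' <- _] := c'E mu; apply: eq_bdry => L.
have [symL|nsymL] := boolP (is_symbol (pow_map A) q t.+1 L).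
  by rewrite -[L]/(val (Sub L symL : sym t.+1)) ext_val yE.
rewrite ext_out //; apply/esym/eqP; apply: contraNT nsymL => /supp_c'[/andP[admL _] sz].
by rewrite is_symbolE // admL sz addnS /=.
Qed.

End Differential.

(** * Minimality, and the image of the last differential *)

Section Ideals.
Variable S : comNzRingType.

Lemma submod_gen_mem (V : lmodType S) (G : V -> Prop) x : G x -> submod_gen G x.
Proof.
move=> Gx; exists [:: (1, x)]; split=> [p|]; last by rewrite big_seq1 scale1r.
by rewrite inE => /eqP ->.
Qed.

Lemma submod_gen_lin (V : lmodType S) (G : V -> Prop) a x y :
  submod_gen G x -> submod_gen G y -> submod_gen G (a *: x + y).
Proof.
move=> [s [Gs ->]] [t [Gt ->]].
exists ([seq (a * p.1, p.2) | p <- s] ++ t); split=> [p|].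
  by rewrite mem_cat => /orP[/mapP[p' /Gs ? ->]|/Gt].
rewrite big_cat big_map scaler_sumr; congr (_ + _).
by apply: eq_bigr => p _ /=; rewrite scalerA.
Qed.

Lemma submod_gen0 (V : lmodType S) (G : V -> Prop) : submod_gen G 0.
Proof. by exists [::]; split=> //; rewrite big_nil. Qed.

Lemma submod_gen_sum (V : lmodType S) (G : V -> Prop) (I : Type) (r : seq I) (Q : pred I)
    (a : I -> S) (F : I -> V) :
  (forall i, Q i -> submod_gen G (F i)) -> submod_gen G (\sum_(i <- r | Q i) a i *: F i).
Proof.
move=> GF; elim/big_rec: _ => [|i x Qi Gx]; first exact: submod_gen0.
by apply: submod_gen_lin => //; apply: GF.
Qed.

Lemma submod_gen_sub (V : lmodType S) (G H : V -> Prop) :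
    H 0 -> (forall a x y, H x -> H y -> H (a *: x + y)) ->
    (forall x, G x -> H x) -> forall x, submod_gen G x -> H x.
Proof.
move=> H0 HD GH x [s [Gs ->]]; rewrite big_seq.
by elim/big_rec: _ => // p y /Gs/GH Hp Hy; apply: HD.
Qed.

Lemma ideal_gen_lin (G : S -> Prop) a x y :
  ideal_gen G x -> ideal_gen G y -> ideal_gen G (a * x + y).
Proof. exact: (@submod_gen_lin S^o). Qed.

Lemma ideal_gen_congrM (G : S -> Prop) x x' y y' :
  ideal_gen G (x - x') -> ideal_gen G (y - y') -> ideal_gen G (x * y - x' * y').
Proof.
move=> Gx Gy; have -> : x * y - x' * y' = y * (x - x') + (x' * (y - y') + 0).
  by rewrite addr0 !mulrBr [y * x]mulrC [y * x']mulrC addrA subrK.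
by do 2![apply: ideal_gen_lin => //]; apply: submod_gen0.
Qed.

(** Multilinear expansion of a product of elements of an ideal, one factor at a
    time; [z] holds the generators that have already been chosen. *)
Lemma ideal_prod (G H : S -> Prop) (fs : seq S) (z : S) :
    H 0 -> (forall a x y, H x -> H y -> H (a * x + y)) ->
    (forall f, f \in fs -> ideal_gen G f) ->
    (forall gs, size gs = size fs -> (forall g, g \in gs -> G g) -> H (z * \prod_(g <- gs) g)) ->
  H (z * \prod_(f <- fs) f).
Proof.
move=> H0 HD; elim: fs z => [|f fs IHfs] z Gfs Hgs; first by apply: Hgs.
have [s [Gs fE]] : ideal_gen G f by apply: Gfs; rewrite mem_head.
rewrite big_cons {}fE mulr_suml mulr_sumr big_seq.
elim/big_rec: _ => // p x /Gs Gp Hx.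
suff Hp : H (z * p.2 * \prod_(f <- fs) f).
  by rewrite -[p.1 *: p.2]/(p.1 * p.2) -mulrA mulrCA [z * _]mulrA; apply: HD.
apply: IHfs => [f' fs_f'|gs size_gs Ggs]; first by apply: Gfs; rewrite inE fs_f' orbT.
have := Hgs (p.2 :: gs); rewrite big_cons mulrA; apply=> [|g]; first by rewrite /= size_gs.
by rewrite inE => /predU1P[->|/Ggs].
Qed.

End Ideals.

Section OrderStatistics.
Variables (n k : nat) (d : Order.disp_t) (P : finPOrderType d) (A : P -> {set 'I_n}).

Lemma isotone_mapsP (d' : Order.disp_t) (Q : finPOrderType d') (B : Q -> {set 'I_n})
    (f : {ffun Q -> 'I_n}) :
  reflect ((forall x y, (x <= y)%O -> (f x <= f y)%N) /\ (forall x, f x \in B x))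
    (f \in isotone_maps B).
Proof.
rewrite inE; apply: (iffP andP) => -[f_mono fB]; split.
- by move=> x y le_xy; move/forallP: f_mono => /(_ x)/forallP/(_ y)/implyP; apply.
- exact/forallP.
- by apply/forallP => x; apply/forallP => y; apply/implyP; apply: f_mono.
- exact/forallP.
Qed.

(** The s-th smallest of the values f_1(p), ..., f_k(p) increases with s.  It also
    increases with p: it is at most v exactly when more than s of the values are
    (counting s from 0), and the number of values at most v decreases with p. *)
Lemma order_statistics (f : 'I_k -> {ffun P -> 'I_n}) :
    (forall i, f i \in isotone_maps A) ->
  exists2 g : {ffun pow_poset k P -> 'I_n}, g \in isotone_maps (pow_map A)
    & forall p, perm_eq [seq f i p | i <- enum 'I_k] [seq g (p, s) | s <- enum 'I_k].
Proof.
move=> f_iso; have fP i := isotone_mapsP _ _ (f_iso i).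
pose T p := sort <=%O [seq f i p | i <- enum 'I_k].
have sizeT p : size (T p) = k by rewrite size_sort size_map size_enum_ord.
have sortedT p : sorted <=%O (T p) by apply: sort_le_sorted.
pose g := [ffun x : pow_poset k P => nth (f x.2 x.1) (T x.1) x.2].
have gE p x0 (s : 'I_k) : g (p, s) = nth x0 (T p) s.
  by rewrite ffunE; apply: set_nth_default; rewrite sizeT.
exists g => [|p]; last first.
  rewrite perm_sym; have -> : [seq g (p, s) | s <- enum 'I_k] = T p.
    have [k_gt0|] := boolP (0 < k)%N; last first.
      rewrite -eqn0Ngt => k0; transitivity (Nil 'I_n); first apply/nilP.
        by rewrite /nilp size_map size_enum_ord.
      by apply/esym/nilP; rewrite /nilp sizeT.
    pose x0 := f (Ordinal k_gt0) p.
    apply: (@eq_from_nth _ x0) => [|i]; rewrite size_map size_enum_ord ?sizeT // => lt_ik.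
    by rewrite (nth_map (Ordinal lt_ik)) ?size_enum_ord // (gE _ x0) nth_enum_ord.
  by rewrite /T perm_sort.
apply/isotone_mapsP; split=> [[p s] [p' s']|[p s]]; last first.
  rewrite (gE p (f s p)) /pow_map /=.
  have : nth (f s p) (T p) s \in T p by rewrite mem_nth ?sizeT.
  by rewrite mem_sort => /mapP[i _ ->]; case: (fP i) => _ ->.
rewrite Order.ProdOrder.leEprod /= => /andP[le_p le_s].
apply: (@leq_trans (g (p', s))).
  rewrite (gE p (f s p)) (gE p' (f s p)); set v := nth _ (T p') s.
  suff : (nth (f s p) (T p) s <= v :> 'I_n)%O by []; apply: nth_count_le => //.
  have : (s < count (<= v)%O (T p'))%N.
    rewrite ltnNge; apply/negP => le_cnt.
    have := @nth_count_gt _ _ v (f s p) (T p') s (sortedT p').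
    by rewrite le_cnt sizeT ltn_ord -/v ltxx => /(_ isT).
  move/leq_trans; apply; rewrite !count_sort !count_map; apply: sub_count => i /=.
  by apply: le_trans; case: (fP i) => mono _; apply: mono.
rewrite !(gE p' (f s p')).
suff : (nth (f s p') (T p') s <= nth (f s p') (T p') s' :> 'I_n)%O by [].
by apply: (sorted_leq_nth le_trans lexx) => //; rewrite inE sizeT.
Qed.

End OrderStatistics.

Section PowerIdeal.
Variables (K : fieldType) (n k : nat) (d : Order.disp_t).
Variables (P : finPOrderType d) (A : P -> {set 'I_n}).
Local Notation M := (#|P| * k)%N.
Variable q : 'I_M -> pow_poset k P.
Hypothesis q_bij : bijective q.
Hypothesis M_gt0 : (0 < M)%N.
Local Notation S := {mpoly K[#|pvar A|]}.
Local Notation G := (power_resolution K A q).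
Local Notation sym := (symbol (pow_map A) q).

Lemma irrelevantX (N : nat) (m : 'X_{1..N}) : m != 0%MM -> irrelevant ('X_[m] : {mpoly K[N]}).
Proof.
move=> m0; have [i mi] : exists i, m i != 0%N.
  apply/existsP; apply: contraNT m0 => /existsPn m0; apply/eqP/mnmP => i.
  by rewrite mnm0E; apply/eqP; have := m0 i; rewrite negbK.
exists [:: ('X_[m - U_(i)], 'X_i)]; split=> [p|].
  by rewrite inE => /eqP -> /=; exists i.
by rewrite big_seq1 /= -[RHS]/('X_[_] * 'X_[_]) -mpolyXD submK // lep1mP.
Qed.

Lemma irrelevant_Xvar x a : a \in A x -> irrelevant (Xvar K A x a).
Proof.
move=> Axa; apply: irrelevantX; have [i _ ->] := Xdeg_in Axa.
by rewrite mnm1_eq0.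
Qed.

Lemma ideal_smul_lin_ext (N : nat) (B : finType) (V : lmodType {mpoly K[N]})
    (I : {mpoly K[N]} -> Prop) (g : B -> V) x :
  (forall b, ideal_smul I (g b)) -> ideal_smul I (lin_ext g x).
Proof. by move=> Ig; rewrite lin_extE; apply: submod_gen_sum => b _; apply: Ig. Qed.

Lemma ideal_smul_ffun (N : nat) (B : finType) (I : {mpoly K[N]} -> Prop)
    (x : {ffun B -> {mpoly K[N]}^o}) : (forall b, ideal_gen I (x b)) -> ideal_smul I x.
Proof.
move=> Ix; pose delta b : {ffun B -> {mpoly K[N]}^o} := [ffun b' => (b' == b)%:R].
have -> : x = \sum_b (1 : {mpoly K[N]}) *: ((x b : {mpoly K[N]}) *: delta b).
  apply/ffunP => b; rewrite sum_ffunE.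
  transitivity (\sum_b' (x b' : {mpoly K[N]}) * (b == b')%:R).
    rewrite (bigD1 b) //= eqxx mulr1 big1 ?addr0 // => b' ne.
    by rewrite eq_sym (negPf ne) mulr0.
  by apply: eq_bigr => b' _; rewrite scale1r ffunE ffunE.
apply: submod_gen_sum => b _; have [s [Is ->]] := Ix b.
exists [seq (p.1, p.2 *: delta b) | p <- s]; split=> [p|].
  by case/mapP => p' /Is Ip ->; exists p'.2, (delta b).
rewrite big_map scaler_suml; apply: eq_bigr => p _.
by rewrite scalerA.
Qed.

Lemma symbol_cell t (e : sym t) x : has_cell (val e) x -> x.2 \in A (q x.1).1.
Proof.
have := valP e; rewrite is_symbolE // => /andP[adm _].
by apply: (subsetP (admissible_sub x.1 adm)).
Qed.

(** Every entry of a differential is a combination of variables, and the entries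
    of d_0 are monomials different from 1 as there is at least one index. *)
Lemma power_minimal : minimal G.
Proof.
split=> [x|t x]; apply: ideal_smul_lin_ext => e.
  rewrite cd0_power; apply: submod_gen_mem; exists 'X_[tdeg A q (val e)], 1.
  split; last by rewrite -[RHS]/(_ * _) mulr1.
  have := valP e; rewrite is_symbolE // => /andP[adm _].
  pose u := Ordinal M_gt0.
  have /set0Pn[a ua] : val e u != set0 by move/forallP: (admissible_nonempty adm).
  apply: irrelevantX; rewrite (@tdeg_rem _ _ _ _ _ _ _ (u, a)) //.
  have [i _ ->] := Xdeg_in (@symbol_cell _ e (u, a) ua).
  by rewrite mnmD_eq0 mnm1_eq0.
apply: ideal_smul_ffun => f; apply: submod_gen_mem; rewrite cd_power.
have irr0 : irrelevant (0 : S) by apply: submod_gen0.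
apply: (big_rec (fun p : S => irrelevant p)) => // z p /andP[ez _] irrp.
case: eqP => _; last by rewrite add0r.
rewrite -mul_mpolyC; apply: (@submod_gen_lin _ S^o) => //.
exact: irrelevant_Xvar (symbol_cell ez).
Qed.

Lemma prod_tdeg (L : {ffun 'I_M -> {set 'I_n}}) (g : pow_poset k P -> 'I_n) :
  (forall u, L u = [set g (q u)]) ->
  ('X_[tdeg A q L] : S) = \prod_(s < k) \prod_p Xvar K A p (g (p, s)).
Proof.
move=> LE; rewrite tdeg_sum -mprodXE.
transitivity (\prod_(x : pow_poset k P) Xvar K A x.1 (g x)).
  rewrite (reindex q) /=; last exact: onW_bij.
  by apply: eq_bigr => u _; rewrite LE big_set1.
rewrite exchange_big /= pair_bigA /=.
by apply: eq_bigr => -[p s] _.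
Qed.

Definition single (g : pow_poset k P -> 'I_n) : {ffun 'I_M -> {set 'I_n}} :=
  [ffun u => [set g (q u)]].

Lemma single_symbol (g : {ffun pow_poset k P -> 'I_n}) :
  g \in isotone_maps (pow_map A) -> is_symbol (pow_map A) q 0 (single g).
Proof.
case/isotone_mapsP=> g_mono gA; rewrite is_symbolE //; apply/andP; split; last first.
  rewrite addn0 /csize (eq_bigr (fun=> 1%N)) => [|u _]; last by rewrite ffunE cards1.
  by rewrite sum1_card card_ord.
apply/andP; split.
  apply/forallP => u; rewrite ffunE sub1set gA andbT; apply/set0Pn.
  by exists (g (q u)); rewrite inE.
apply/orderedP => u v a b lt; rewrite !ffunE !inE => /eqP -> /eqP ->.
by apply: g_mono; apply: ltW.
Qed.

Lemma symbol0_single (e : sym 0) :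
  exists2 g : {ffun pow_poset k P -> 'I_n},
    g \in isotone_maps (pow_map A) & val e = single g.
Proof.
have := valP e; case/and4P => sL /eqP sz _ /exists_inP[g g_iso /forallP gL].
exists g => //; apply/ffunP => u; rewrite ffunE.
have L_gt0 v : (0 < #|val e v|)%N by rewrite card_gt0; case/andP: (forallP sL v).
have /eqP : (\sum_v (#|val e v|).-1 = 0)%N.
  have : (\sum_v (#|val e v|.-1 + 1) = 0 + M)%N.
    by rewrite addnC -sz; apply: eq_bigr => v _; rewrite addn1 prednK.
  rewrite big_split /= sum_nat_const card_ord muln1 => /eqP.
  by rewrite eqn_add2r => /eqP.
rewrite sum_nat_eq0 => /forallP/(_ u)/eqP L1.
apply/eqP; rewrite eq_sym eqEcard sub1set cards1 -(prednK (L_gt0 u)) L1 andbT.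
by case/andP: (gL u).
Qed.

(** The symbols of F_0 are the isotone maps on P^k.  Its k layers are isotone
    maps on P, so that d_0 takes values in the k-th power; conversely, sorting
    turns any k isotone maps on P into the layers of one isotone map on P^k. *)
Lemma power_image s : ideal_pow (letterplace K A) k s <-> exists x, cdiff0 G x = s.
Proof.
pose H s := exists x, cdiff0 G x = s.
have H0 : H 0 by exists 0; rewrite linear0.
have HD a x y : H x -> H y -> H (a * x + y).
  by case=> x' <- [y' <-]; exists (a *: x' + y'); rewrite linearP.
have cdE (e : cbasis G 0) : exists2 g : {ffun pow_poset k P -> 'I_n},
    g \in isotone_maps (pow_map A) &
    (cd0 e : S) = \prod_(s < k) \prod_p Xvar K A p (g (p, s)).
  have [g g_iso eg] := symbol0_single e; exists g => //.
  by rewrite cd0_power; apply: prod_tdeg => u; rewrite eg ffunE.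
split=> [|[x <-]]; last first.
  apply: submod_gen_sum => e _; apply: submod_gen_mem.
  have [g /isotone_mapsP[g_mono gA] ->] := cdE e.
  exists (fun s => \prod_p Xvar K A p (g (p, s))); split=> // i.
  apply: submod_gen_mem; exists [ffun p => g (p, i)].
    apply/isotone_mapsP; split=> [p p' le_p|p]; rewrite !ffunE.
      by apply: g_mono; rewrite Order.ProdOrder.leEprod /= le_p lexx.
    exact: (gA (p, i)).
  by apply: eq_bigr => p _; rewrite ffunE.
apply: (@submod_gen_sub _ S^o _ H) => // _ [f [If ->]].
have -> : \prod_i f i = 1 * \prod_(x <- [seq f i | i <- enum 'I_k]) x.
  by rewrite mul1r big_map big_enum.
apply: (@ideal_prod _ (fun u => exists2 g : {ffun P -> 'I_n},
   g \in isotone_maps A & u = \prod_x Xvar K A x (g x))) => // [_ /mapP[i _ ->]|gs];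
  first exact: If.
rewrite size_map size_enum_ord => size_gs Ggs; rewrite mul1r.
have ex_g (i : 'I_k) : exists g : {ffun P -> 'I_n},
    g \in isotone_maps A /\ gs`_i = \prod_x Xvar K A x (g x).
  by have [|g ? ?] := Ggs gs`_i; [rewrite mem_nth ?size_gs | exists g].
have [g gE] := fin_all_exists ex_g.
have [|h h_iso hE] := @order_statistics _ _ _ _ A g; first by move=> i; case: (gE i).
exists [ffun e' => (e' == (Sub (single h) (single_symbol h_iso) : sym 0))%:R].
rewrite [LHS](@lin_ext_delta _ _ _ S^o) cd0_power.
transitivity (\prod_(s < k) \prod_p Xvar K A p (h (p, s))).
  by apply: prod_tdeg => u; rewrite ffunE.
rewrite (big_nth 0) big_mkord size_gs exchange_big /=.
rewrite [RHS](eq_bigr (fun i => \prod_p Xvar K A p (g i p))) => [|i _]; last by case: (gE i).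
rewrite [RHS]exchange_big /=; apply: eq_bigr => p _.
transitivity (\prod_(a <- [seq h (p, s) | s <- enum 'I_k]) Xvar K A p a).
  by rewrite big_map big_enum.
by rewrite -(perm_big _ (hE p)) big_map big_enum.
Qed.

Hypothesis q_linear : forall u v, (q u < q v)%O -> (u < v)%N.

Lemma power_resolves : resolves G (ideal_pow (letterplace K A) k).
Proof.
split=> [s|x|t x]; first exact: power_image.
  exact: (power_exact q_bij q_linear x).
exact: (power_exact q_bij q_linear (t := t.+1) x).
Qed.

Lemma power_mmfr : multigraded_minimal_free_resolution G (ideal_pow (letterplace K A) k).
Proof. split; [exact: power_multigraded | exact: power_resolves | exact: power_minimal]. Qed.

End PowerIdeal.

(** * Uniqueness of minimal resolutions, and the quotient complex *)

Section Uniqueness.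
Variables (K : fieldType) (N : nat) (I : {mpoly K[N]} -> Prop).
Variables G G' : mfcomplex K N.
Hypothesis resG : multigraded_minimal_free_resolution G I.
Hypothesis resG' : multigraded_minimal_free_resolution G' I.
Local Notation S := {mpoly K[N]}.

Lemma cycle_is_boundary (H : mfcomplex K N) t (x : cterm H t) :
  resolves H I -> is_cycle x <-> exists y, cdiff H t y = x.
Proof. by case=> _ ex0 ex; case: t x => [|t] x; [apply: ex0 | apply: ex]. Qed.

Lemma cycle_irrelevant (H : mfcomplex K N) t (x : cterm H t) :
  multigraded_minimal_free_resolution H I -> is_cycle x -> ideal_smul (@irrelevant K N) x.
Proof. by case=> _ resH [_ minH] /(cycle_is_boundary _ resH)[y <-]; apply: minH. Qed.

Definition comparison t (p : cbasis G t -> cterm G' t) : Prop :=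
  [/\ forall e, has_mdeg (@cmdeg _ _ G' t) (cmdeg e) (p e), bijective (lin_ext p)
    & forall x : cterm G t, is_cycle x <-> is_cycle (lin_ext p x : cterm G' t)].

(** The bottom of the induction: both complexes minimally cover the ideal itself,
    viewed inside the free module of rank one in degree 0. *)
Lemma comparison0 : exists2 p : cbasis G 0 -> cterm G' 0,
  comparison p & forall x, cdiff0 G' (lin_ext p x) = cdiff0 G x.
Proof.
have [mG exG _] := resG; have [mG' exG' _] := resG'.
(* The ring is replaced by the functions on unit, to fit the case of free modules. *)
pose aug0 (H : mfcomplex K N) (e : cbasis H 0) : {ffun unit -> S^o} := [ffun=> cd0 e].
have aug0E H (x : cterm H 0) : lin_ext (aug0 H) x = [ffun=> cdiff0 H x].
  apply/ffunP => u; rewrite lin_ext_coef ffunE.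
  by apply: eq_bigr => e _; rewrite ffunE.
have aug0_mdeg H : multigraded H ->
    forall e, has_mdeg (fun=> 0%MM) (cmdeg e) (aug0 H e).
  by case=> mH _ e u m; rewrite ffunE addm0 => /mH.
have aug0_im H y : resolves H I -> (exists x, lin_ext (aug0 H) x = y) <-> I (y tt).
  case=> imH _ _; split=> [[x <-]|/imH[x xE]].
    by rewrite aug0E ffunE; apply/imH; exists x.
  by exists x; rewrite aug0E; apply/ffunP => -[]; rewrite ffunE.
have aug0_ker H (x : cterm H 0) : multigraded_minimal_free_resolution H I ->
    lin_ext (aug0 H) x = 0 -> ideal_smul (@irrelevant K N) x.
  move=> resH; rewrite aug0E => /ffunP/(_ tt); rewrite !ffunE => x0.
  exact: (@cycle_irrelevant H 0 x resH x0).
have [|||||p [pm pb pE]] := @minimal_cover_unique K N _ (fun=> 0%MM) _ _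
    (@cmdeg _ _ G 0) (@cmdeg _ _ G' 0) (aug0 G) (aug0 G').
- exact: aug0_mdeg.
- exact: aug0_mdeg.
- by move=> y; apply: iff_trans (aug0_im _ _ exG) (iff_sym (aug0_im _ _ exG')).
- by move=> x; apply: aug0_ker.
- by move=> x; apply: aug0_ker.
have {}pE x : cdiff0 G' (lin_ext p x) = cdiff0 G x.
  by have := pE x; rewrite !aug0E => /ffunP/(_ tt); rewrite !ffunE.
by exists p => //; split=> // x /=; rewrite pE.
Qed.

(** An isomorphism in degree t that respects cycles identifies the two modules of
    cycles, which are minimally covered by the terms of degree t + 1. *)
Lemma comparisonS t (p : cbasis G t -> cterm G' t) : comparison p ->
  exists2 p' : cbasis G t.+1 -> cterm G' t.+1, comparison p' &
    forall x, cdiff G' t (lin_ext p' x) = lin_ext p (cdiff G t x).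
Proof.
have [[_ mG] exG _] := resG; have [[_ mG'] exG' _] := resG'.
case=> pm pb pker; have [pV pK pVK] := pb.
pose g1 (e : cbasis G t.+1) : cterm G' t := lin_ext p (cd e).
have g1E x : lin_ext g1 x = lin_ext p (cdiff G t x) by rewrite -lin_ext_comp.
have p_eq0 x : lin_ext p x = 0 -> x = 0.
  by rewrite -[X in _ = X -> _](raddf0 (lin_ext p)); apply: can_inj pK _ _.
have [|||||p' [pm' pb' pE]] := @minimal_cover_unique K N _ (@cmdeg _ _ G' t) _ _
    (@cmdeg _ _ G t.+1) (@cmdeg _ _ G' t.+1) g1 (@cd _ _ G' t).
- by move=> e; apply: (lin_ext_has_mdeg pm); apply: mG.
- exact: mG'.
- move=> y; split=> [[x]|[x xE]].
    rewrite g1E => <-; apply/(cycle_is_boundary _ exG')/pker/(cycle_is_boundary _ exG).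
    by exists x.
  have : is_cycle (y : cterm G' t) by apply/(cycle_is_boundary _ exG'); exists x.
  rewrite -(pVK y) => /pker/(cycle_is_boundary _ exG)[z zE].
  by exists z; rewrite g1E zE.
- by move=> x; rewrite g1E => /p_eq0 x0; apply: (@cycle_irrelevant G t.+1 x resG x0).
- by move=> x x0; apply: (@cycle_irrelevant G' t.+1 x resG' x0).
have {}pE x : cdiff G' t (lin_ext p' x) = lin_ext p (cdiff G t x).
  by rewrite -g1E; apply: pE.
exists p' => //; split=> // x; split=> x0.
  exact: etrans (pE x) (etrans (congr1 (lin_ext p) x0) (raddf0 _)).
by apply: p_eq0; rewrite -pE.
Qed.

Lemma resolution_unique : exists p : forall t, cbasis G t -> cterm G' t,
  [/\ forall t e, has_mdeg (@cmdeg _ _ G' t) (cmdeg e) (p t e),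
      forall t, bijective (lin_ext (p t)),
      forall x, cdiff0 G' (lin_ext (p 0) x) = cdiff0 G x
    & forall t x, cdiff G' t (lin_ext (p t.+1) x) = lin_ext (p t) (cdiff G t x)].
Proof.
pose state t := {p : cbasis G t -> cterm G' t | comparison p}.
have [p0 p0c p0E] := comparison0.
have step t (s : state t) : {s' : state t.+1 | forall x,
    cdiff G' t (lin_ext (sval s') x) = lin_ext (sval s) (cdiff G t x)}.
  apply: cid; have [p' p'c p'E] := comparisonS (svalP s).
  by exists (exist _ p' p'c).
pose fix states t : state t :=
  match t with 0 => exist _ p0 p0c | t.+1 => sval (step t (states t)) end.
exists (fun t => sval (states t)); split=> [t e|t||t x].
- by case: (svalP (states t)) => + _ _; apply.
- by case: (svalP (states t)).
- exact: p0E.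
- exact: (svalP (step t (states t))).
Qed.

End Uniqueness.

Lemma mpoly_alg_ind (K : fieldType) (N : nat) (Pr : {mpoly K[N]} -> Prop) :
    Pr 1 -> (forall c p r, Pr p -> Pr r -> Pr (c *: p + r)) ->
    (forall p r, Pr p -> Pr r -> Pr (p * r)) -> (forall i, Pr 'X_i) ->
  forall p, Pr p.
Proof.
move=> P1 PD PM PX p.
have P0 : Pr 0 by rewrite -(addNr (1 : {mpoly K[N]})) -scaleN1r; apply: (PD).
rewrite [p]mpolyE; elim/big_rec: _ => // m r _ Pr_r; apply: (PD) => //.
rewrite mpolyXE_id; elim/big_rec: _ => // i s _ Ps; apply: (PM) => //.
by elim: (m i) => [|j IHj]; rewrite ?expr0 // exprS; apply: PM.
Qed.

Section Quotient.
Variables (K : fieldType) (NT NR : nat).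
Variables (rho : {rmorphism {mpoly K[NT]} -> {mpoly K[NR]}}).
Variables (rhodeg : 'X_{1..NT} -> 'X_{1..NR}) (J : {mpoly K[NT]} -> Prop).
Hypothesis rhodegD : {morph rhodeg : m1 m2 / (m1 + m2)%MM}.
Hypothesis rho_supp : forall p m, m \in msupp (rho p) ->
  exists2 m', m' \in msupp p & m = rhodeg m'.
Hypothesis rho_surj : forall r, exists s, rho s = r.
Hypothesis kerJ : forall s, J s <-> rho s = 0.
Variables (F : mfcomplex K NT) (G : mfcomplex K NR).
Local Notation T := {mpoly K[NT]}.
Local Notation R := {mpoly K[NR]}.
Local Notation FR := (base_change rho rhodeg F).

Definition rho_ffun (B : finType) (x : {ffun B -> T^o}) : {ffun B -> R^o} :=
  [ffun e => rho (x e : T)].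

(** F_t/JF_t is the free R-module on the same basis. *)
Lemma rho_ffun_eq (B : finType) (x y : {ffun B -> T^o}) :
  rho_ffun x = rho_ffun y <-> ideal_smul J (x - y).
Proof.
split=> [/ffunP eqxy|Jxy].
  apply: ideal_smul_ffun => b; apply: submod_gen_mem; apply/kerJ.
  have := eqxy b; rewrite !ffunE -[in rho _]/((x b : T) - (y b : T)) rmorphB => ->.
  by rewrite subrr.
apply/ffunP => b; rewrite !ffunE; apply/eqP; rewrite -subr_eq0 -rmorphB; apply/eqP.
case: Jxy => s [Gs xyE]; have -> : (x b : T) - y b = (x - y) b by rewrite !ffunE.
rewrite xyE sum_ffunE rmorph_sum big_seq big1 // => p /Gs[r [v [Jr ->]]].
rewrite !ffunE -[_ *: _]/(p.1 * (r * (v b : T))) !rmorphM.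
by rewrite (proj1 (kerJ r) Jr) mul0r mulr0.
Qed.

Lemma rho_ffunZD (B : finType) (a : T) (x y : {ffun B -> T^o}) :
  rho_ffun (a *: x + y) = rho a *: rho_ffun x + rho_ffun y.
Proof.
apply/ffunP => b; rewrite !ffunE -[in LHS]/(a * (x b : T) + (y b : T)).
by rewrite rmorphD rmorphM.
Qed.

Lemma rho_ffun_surj (B : finType) (y : {ffun B -> R^o}) : exists x, rho_ffun x = y.
Proof.
have [s sE] := choice (fun b => rho_surj (y b : R)).
by exists [ffun b => s b]; apply/ffunP => b; rewrite !ffunE.
Qed.

Lemma rho_cdiff t (x : cterm F t.+1) :
  rho_ffun (cdiff F t x) = cdiff FR t (rho_ffun x).
Proof.
apply/ffunP => f; rewrite ffunE [in LHS]lin_ext_coef [RHS]lin_ext_coef rmorph_sum.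
by apply: eq_bigr => e _; rewrite rmorphM !ffunE.
Qed.

Lemma rho_cdiff0 (x : cterm F 0) : rho (cdiff0 F x) = cdiff0 FR (rho_ffun x).
Proof.
rewrite -[cdiff0 F x]/(\sum_e (x e : T) * (cd0 e : T)) rmorph_sum.
by apply: eq_bigr => e _; rewrite rmorphM ffunE.
Qed.

Lemma base_change_quotient_iso (I : R -> Prop) :
  multigraded_minimal_free_resolution FR I ->
  multigraded_minimal_free_resolution G I ->
  quotient_complex_iso rho rhodeg F J G.
Proof.
move=> resFR resG; have [p [p_mdeg p_bij p0 pS]] := resolution_unique resFR resG.
pose phi0 (x : mquot J T^o) := rho (repr x : T).
pose phi t (x : mquot J (cterm F t)) : cterm G t := lin_ext (p t) (rho_ffun (repr x)).
have phi0E s : phi0 (mquot_pi J (s : T^o)) = rho s.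
  have : mquot_pi J (repr (mquot_pi J (s : T^o))) = mquot_pi J (s : T^o).
    exact: mquot_pi_repr.
  move/mquot_pi_eq=> [l [Gl lE]]; apply/eqP; rewrite -subr_eq0 -rmorphB; apply/eqP.
  rewrite [_ - _]lE rmorph_sum big_seq big1 // => z /Gl[r [v [Jr ->]]].
  rewrite -[_ *: _]/(z.1 * (r * (v : T))) !rmorphM.
  by rewrite (proj1 (kerJ r) Jr) mul0r mulr0.
have phiE t x : phi t (mquot_pi J x) = lin_ext (p t) (rho_ffun x).
  by congr (lin_ext _ _); apply/rho_ffun_eq/mquot_pi_eq; rewrite mquot_pi_repr.
exists phi0, phi; split.
- split=> //; apply: injective_surjective_bijective => [x y|r].
    rewrite -[x]mquot_pi_repr -[y]mquot_pi_repr !phi0E => eqxy.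
    apply/mquot_pi_eq/submod_gen_mem; exists ((repr x : T) - repr y), 1.
    split; last by rewrite -[RHS]/(_ * _) mulr1.
    by apply/kerJ; rewrite rmorphB eqxy subrr.
  by have [s <-] := rho_surj r; exists (mquot_pi J (s : T^o)).
- move=> t; apply: injective_surjective_bijective => [x y|y].
    rewrite -[x]mquot_pi_repr -[y]mquot_pi_repr !phiE => /(bij_inj (p_bij t)).
    by move/rho_ffun_eq/mquot_pi_eq.
  have [r _ rK] := p_bij t; have [x xE] := rho_ffun_surj (r y).
  by exists (mquot_pi J x); rewrite phiE xE rK.
- move=> t a x y; rewrite -[x]mquot_pi_repr -[y]mquot_pi_repr !phiE.
  rewrite -[_ *: mquot_pi J _]/(mquot_scale a _) mquot_piZ -mquot_piD phiE rho_ffunZD.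
  exact: linearP.
- split=> [x|t x]; rewrite -[x]mquot_pi_repr mquot_mapE.
    by rewrite phi0E phiE p0; apply: rho_cdiff0.
  by rewrite !phiE pS; congr (lin_ext _ _); apply: rho_cdiff.
move=> t mu x hx; rewrite phiE; apply: (lin_ext_has_mdeg (p_mdeg t)) => e m.
rewrite ffunE => /rho_supp[m' xm' ->].
by rewrite -(hx e m' xm') rhodegD.
Qed.

End Quotient.

(** * The kernel of the specialization *)

Section DiagonalKernel.
Variables (K : fieldType) (n k : nat) (d : Order.disp_t).
Variables (P : finPOrderType d) (A : P -> {set 'I_n}).
Hypothesis k_gt0 : (0 < k)%N.
Local Notation T := {mpoly K[#|pvar (pow_map (k := k) A)|]}.
Local Notation R := {mpoly K[#|pvar A|]}.
Local Notation rho := (diag_map K k A).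
Local Notation J := (diag_ideal K k A).
Let s0 : 'I_k := Ordinal k_gt0.

Lemma mpolyX_Xvar (d' : Order.disp_t) (Q : finPOrderType d') (B : Q -> {set 'I_n})
  (i : 'I_#|pvar B|) : 'X_i = Xvar K B (pvar_val i).1 (pvar_val i).2.
Proof. by rewrite /Xvar Xdeg_pvar. Qed.

Lemma pvarP (d' : Order.disp_t) (Q : finPOrderType d') (B : Q -> {set 'I_n})
  (i : 'I_#|pvar B|) : (pvar_val i).2 \in B (pvar_val i).1.
Proof. exact: (valP (enum_val i)). Qed.

Definition first_layer (r : R) : T :=
  comp_mpoly [tuple Xvar K (pow_map (k := k) A) ((pvar_val i).1, s0) (pvar_val i).2
             | i < #|pvar A|] r.
HB.instance Definition _ := GRing.RMorphism.copy first_layer (comp_mpoly _).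

Lemma first_layerZ c r : first_layer (c *: r) = c *: first_layer r.
Proof. exact: comp_mpolyZ. Qed.

Lemma first_layer_Xvar p a : a \in A p ->
  first_layer (Xvar K A p a) = Xvar K (pow_map A) (p, s0) a.
Proof.
move=> Ap; have [i ei Xi] := Xdeg_in Ap.
by rewrite /first_layer /Xvar Xi /comp_mpoly mmapX mmap1U tnth_mktuple ei.
Qed.

Lemma diag_map_surj r : exists s, rho s = r.
Proof.
exists (first_layer r); elim/mpoly_alg_ind: r => [|c p r IHp IHr|p r IHp IHr|i].
- by rewrite !rmorph1.
- by rewrite !rmorphD /= first_layerZ diag_mapZ IHp IHr.
- by rewrite !rmorphM /= IHp IHr.
by rewrite mpolyX_Xvar first_layer_Xvar ?pvarP // diag_map_Xvar.
Qed.

(** Telescoping over the layers below s. *)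
Lemma diag_ideal_layer p a (s : 'I_k) : a \in A p ->
  J (Xvar K (pow_map A) (p, s) a - Xvar K (pow_map A) (p, s0) a).
Proof.
move=> Ap; case: s => m lt_m; elim: m lt_m => [|m IHm] lt_m.
  rewrite (_ : Ordinal lt_m = s0) ?subrr; first exact: submod_gen0.
  exact: val_inj.
have lt_m' := ltnW lt_m.
pose X t := Xvar K (pow_map (k := k) A) (p, t) a.
have -> : X (Ordinal lt_m) - X s0
    = (-1 : T) * (X (Ordinal lt_m') - X (Ordinal lt_m)) + (X (Ordinal lt_m') - X s0).
  by rewrite mulN1r opprB addrA subrK.
apply: ideal_gen_lin; last exact: IHm.
by apply: submod_gen_mem; exists p, a, (Ordinal lt_m'), (Ordinal lt_m).
Qed.

(** Modulo J every polynomial agrees with the one obtained by specializing and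
    going back to the first layer: this holds for the variables, and both sides
    are multiplicative and linear. *)
Lemma diag_map_ker s : J s <-> rho s = 0.
Proof.
split=> [|s0E].
  move: s; apply: (@submod_gen_sub _ T^o _ (fun s : T => rho s = 0)).
  - exact: rmorph0.
  - move=> a x y x0 y0.
    by rewrite -[_ *: _]/(a * (x : T)) rmorphD rmorphM /= x0 y0 mulr0 addr0.
  by move=> _ [p [a [s [s' [_ _ ->]]]]]; rewrite rmorphB /= !diag_map_Xvar subrr.
have : J (s - first_layer (rho s)).
  elim/mpoly_alg_ind: s {s0E} => [|c p r IHp IHr|p r IHp IHr|i].
  - by rewrite !rmorph1 subrr; apply: submod_gen0.
  - rewrite !rmorphD /= diag_mapZ first_layerZ opprD addrACA -scalerBr -mul_mpolyC.
    exact (ideal_gen_lin c%:MP IHp IHr).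
  - rewrite !rmorphM /=.
    exact (ideal_gen_congrM IHp IHr).
  rewrite mpolyX_Xvar diag_map_Xvar first_layer_Xvar ?(pvarP i) //.
  have := pvarP i; case: (pvar_val i) => -[p t] a /= Aa.
  exact: diag_ideal_layer.
by rewrite s0E rmorph0 subr0.
Qed.

End DiagonalKernel.

Local Close Scope ring_scope.

Theorem corollary5p8 (K : fieldType) (n k : nat) (d : Order.disp_t)
    (P : finPOrderType d) (A : P -> {set 'I_n})
    (q : 'I_(#|P| * k) -> pow_poset k P)
    (n_gt0 : 0 < n) (k_gt0 : 0 < k) (P_gt0 : 0 < #|P|)
    (A_neq0 : forall p, A p != set0)
    (HomA_neq0 : isotone_maps A != set0)
    (q_bij : bijective q)
    (q_linear : forall u v, (q u < q v)%O -> u < v) :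
  let Lk := ideal_pow (letterplace K A) k in
  let F := letterplace_resolution K (pow_map A) q in
  let J := diag_ideal K k A in
  (exists G : mfcomplex K #|pvar A|,
     multigraded_minimal_free_resolution G Lk) /\
  (forall G : mfcomplex K #|pvar A|,
     multigraded_minimal_free_resolution G Lk ->
     quotient_complex_iso (diag_map K k A) (diag_deg k A) F J G).
Proof.
have M_gt0 : 0 < #|P| * k by rewrite muln_gt0 P_gt0.
have resL := power_mmfr K A q_bij M_gt0 q_linear.
split; first by eexists; exact: resL.
move=> G; apply: (base_change_quotient_iso _ _ _ _ resL).
- exact: diag_degD.
- exact: diag_map_supp.
- exact: diag_map_surj.
- exact: diag_map_ker.
Qed.
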